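(* Let $M\in\mathbb{Q}^{d\times d}$ and $q\in\mathbb{Q}^d$ be such that the orbit $(M^nq)_{n\in\mathbb{N}}$ is bounded, and let $w\colon\mathbb{R}^d\to\mathbb{R}$ be continuous. Let $m$ be the integer associated with $(M,q)$ as described in the context. Then one can compute a function $f\colon\mathbb{R}^m\to\mathbb{R}$ such that $$\mathcal{MP}_w(M,q)=\int_{\mathbf{x}\in\mathbb{T}^m}f(\mathbf{x})\,d\mathbf{x},\qquad d\mathbf{x}=dx_1\cdots dx_m .$$
   Context: $\mathbb{T}=[0,1)$; $\{x\}$ is the fractional part of $x$; $\overline{\mathbb{Q}}$ is the field of algebraic numbers. The mean payoff is $\mathcal{MP}_w(M,q)=\lim_{n\to\infty}\frac1n\sum_{k=0}^{n-1}w(M^kq)$. ''Compute $f$'' is understood relative to the given weight function $w$: from $M$ and $q$ one effectively obtains an explicit expression for $f$ in terms of $w$ (no computability of $w$ itself is assumed). A linear recurrence sequence (LRS) over a field $K\subseteq\mathbb{C}$ is a sequence $(u_n)_{n\in\mathbb{N}}$ satisfying $u_{n+k}=\sum_{i=0}^{k-1}a_iu_{n+i}$ for all $n$, for some $k\ge1$ and $a_0,\dots,a_{k-1}\in K$; its characteristic roots are the roots of $x^k-\sum_{i}a_ix^i$ for the minimal such recurrence, and it is simple if this polynomial has no repeated root. The integer $m$ arises as follows. For $1\le i\le d$, because the orbit is bounded, the $i$th coordinate sequence $u^{(i)}_n=e_i^\top M^nq$ decomposes as $u^{(i)}_n=v^{(i)}_n+w^{(i)}_n$, where $(v^{(i)}_n)_n$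 is a simple LRS over $\mathbb{R}\cap\overline{\mathbb{Q}}$ all of whose characteristic roots have modulus $1$, and $(w^{(i)}_n)_n$ is an LRS over $\mathbb{R}\cap\overline{\mathbb{Q}}$ all of whose characteristic roots have modulus less than $1$. Let $\{\lambda_1,\ldots,\lambda_\ell\}\subset\overline{\mathbb{Q}}$ be a set of numbers of modulus $1$ containing the characteristic roots of all the $(v^{(i)}_n)_n$, $1\le i\le d$. Fix (computed) integers $R,m>0$, numbers $\theta_1,\ldots,\theta_m\in\mathbb{T}$ such that $1,\theta_1,\ldots,\theta_m$ are linearly independent over $\mathbb{Q}$, and polynomials $p_{i,r}$ ($1\le i\le\ell$, $0\le r<R$) in $2m$ variables with algebraic coefficients, such that for all $n\in\mathbb{N}$ $$\lambda_i^{nR+r}=p_{i,r}\big(\sigma(\boldsymbol\theta_n)\big),$$ where $\boldsymbol\theta_n=(\{n\theta_1\},\ldots,\{n\theta_m\})$ and $\sigma(x_1,\ldots,x_m)=(e^{\mathbf{i}2\pi x_1},e^{-\mathbf{i}2\pi x_1},\ldots,e^{\mathbf{i}2\pi x_m},e^{-\mathbf{i}2\pi x_m})$, with $\mathbf{i}$ the imaginary unit. *)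

(* Defs.v *)
(* The notations of multinomials clash with those of MathComp-Analysis. *)
From HB Require Import structures.
From mathcomp Require Import all_boot all_order all_algebra.
From mathcomp Require Import all_classical all_reals all_analysis.
From mathcomp Require Import complex.
From mathcomp Require Import -(notations) mpoly.

Set Implicit Arguments.
Unset Strict Implicit.
Unset Printing Implicit Defensive.

Import Order.TTheory GRing.Theory Num.Theory.
Import numFieldNormedType.Exports.

Local Open Scope classical_set_scope.
Local Open Scope ring_scope.

(* The model of computation is Jones' language WHILE over binary trees.  A
   program transforms a tree into a tree; [Leaf] plays the role of "nil" and of
   "false", any [Node] that of "true". *)
Inductive btree : Type := Leaf | Node of btree & btree.

Inductive prog : Type :=
| PId
| PLeaf
| PPair of prog & prog
| PFst
| PSnd
| PComp of prog & prog
| PIf of prog & prog & prog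
| PWhile of prog & prog.

(* [run p t u]: the program [p], started on [t], halts with result [u].
   [PComp p q] runs [q] first. *)
Inductive run : prog -> btree -> btree -> Prop :=
| run_id t : run PId t t
| run_leaf t : run PLeaf t Leaf
| run_pair p q t a b : run p t a -> run q t b -> run (PPair p q) t (Node a b)
| run_fst_leaf : run PFst Leaf Leaf
| run_fst a b : run PFst (Node a b) a
| run_snd_leaf : run PSnd Leaf Leaf
| run_snd a b : run PSnd (Node a b) b
| run_comp p q t u v : run q t u -> run p u v -> run (PComp p q) t v
| run_if_false c p q t u : run c t Leaf -> run q t u -> run (PIf c p q) t u
| run_if_true c p q t a b u :
    run c t (Node a b) -> run p t u -> run (PIf c p q) t u
| run_while_stop c p t : run c t Leaf -> run (PWhile c p) t t
| run_while_step c p t a b u v :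
    run c t (Node a b) -> run p t u -> run (PWhile c p) u v ->
    run (PWhile c p) t v.

Definition enc_seq (T : Type) (enc : T -> btree) (s : seq T) : btree :=
  foldr (fun x t => Node (enc x) t) Leaf s.

Definition enc_nat (n : nat) : btree := iter n (Node Leaf) Leaf.

Definition enc_int (z : int) : btree :=
  match z with
  | Posz n => Node Leaf (enc_nat n)
  | Negz n => Node (Node Leaf Leaf) (enc_nat n)
  end.

Definition enc_rat (x : rat) : btree := Node (enc_int (numq x)) (enc_int (denq x)).

Definition enc_fun (T : Type) (enc : T -> btree) (n : nat) (f : 'I_n -> T) : btree :=
  enc_seq enc [seq f i | i <- enum 'I_n].

Definition enc_mx (m n : nat) (A : 'M[rat]_(m, n)) : btree :=
  enc_fun (fun i => enc_fun (fun j => enc_rat (A i j)) (fun j : 'I_n => j))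
          (fun i : 'I_m => i).

(* [ARoot p a b eps] is the usual representation of an algebraic number: the
   only root of [p] at distance less than [eps] from [a + b i]. *)
Inductive aterm : Type :=
| ARat of rat
| ARoot of {poly rat} & rat & rat & rat
| AAdd of aterm & aterm
| AOpp of aterm
| AMul of aterm & aterm
| AInv of aterm.

Fixpoint enc_aterm (t : aterm) : btree :=
  match t with
  | ARat x => Node (enc_nat 0) (enc_rat x)
  | ARoot p a b eps => Node (enc_nat 1)
      (Node (enc_seq enc_rat p) (enc_seq enc_rat [:: a; b; eps]))
  | AAdd t1 t2 => Node (enc_nat 2) (Node (enc_aterm t1) (enc_aterm t2))
  | AOpp t1 => Node (enc_nat 3) (enc_aterm t1)
  | AMul t1 t2 => Node (enc_nat 4) (Node (enc_aterm t1) (enc_aterm t2))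
  | AInv t1 => Node (enc_nat 5) (enc_aterm t1)
  end.

(* A polynomial as a list of pairs (coefficient, exponents). *)
Definition polycode : Type := seq (aterm * seq nat).

Definition enc_polycode (c : polycode) : btree :=
  enc_seq (fun t => Node (enc_aterm t.1) (enc_seq enc_nat t.2)) c.

(* Expressions in a point x of R^m and a function w on R^d: algebraic
   constants, the coordinates of sigma(x), ring operations, and
   [EW [:: e_1; ...; e_d]] for w(Re e_1, ..., Re e_d). *)
Inductive expr : Type :=
| EConst of aterm
| ESigma of nat
| EAdd of expr & expr
| EMul of expr & expr
| EW of seq expr.

Fixpoint enc_expr (e : expr) : btree :=
  match e with
  | EConst t => Node (enc_nat 0) (enc_aterm t)
  | ESigma k => Node (enc_nat 1) (enc_nat k)
  | EAdd e1 e2 => Node (enc_nat 2) (Node (enc_expr e1) (enc_expr e2))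
  | EMul e1 e2 => Node (enc_nat 3) (Node (enc_expr e1) (enc_expr e2))
  | EW es => Node (enc_nat 4) (enc_seq enc_expr es)
  end.

Section Semantics.
Variable R : realType.
Local Notation C := R[i].

Definition algebraic_number : set C :=
  [set z | algebraicOver (ratr : rat -> C) z].

Definition real_algebraic_number : set C :=
  [set z | complex.Im z = 0 /\ algebraic_number z].

Definition roots_near (p : {poly rat}) (a b eps : rat) : set C :=
  [set z | root (map_poly ratr p) z /\
           `|z - (ratr a +i* ratr b)%C| < ratr eps].

(* An ill-formed [ARoot] (no root, or several roots, in the disc) denotes 0;
   also 0^-1 = 0. *)
Fixpoint aterm_val (t : aterm) : C :=
  match t with
  | ARat x => ratr x
  | ARoot p a b eps => xget 0 [set z | roots_near p a b eps = [set z]]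
  | AAdd t1 t2 => aterm_val t1 + aterm_val t2
  | AOpp t1 => - aterm_val t1
  | AMul t1 t2 => aterm_val t1 * aterm_val t2
  | AInv t1 => (aterm_val t1)^-1
  end.

Definition polycode_val (n : nat) (c : polycode) : mpoly n C :=
  \sum_(t <- c)
     aterm_val t.1 *: mpolyX C (Multinom [tuple nth 0%N t.2 k | k < n]).

Definition cis (x : R) : C := (cos x +i* sin x)%C.

Lemma half_ord_proof (m : nat) (k : 'I_m.*2) : (k./2 < m)%N.
Proof.
rewrite -ltn_double (leq_ltn_trans _ (ltn_ord k)) //.
by rewrite -[leqRHS]odd_double_half leq_addl.
Qed.

(* The point (e^(2 pi i x_1), e^(-2 pi i x_1), ..., e^(2 pi i x_m),
   e^(-2 pi i x_m)), indexed from 0. *)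
Definition sigma (m : nat) (x : 'rV[R]_m) (k : 'I_m.*2) : C :=
  let t := 2 * pi * x ord0 (Ordinal (half_ord_proof k)) in
  if odd k then cis (- t) else cis t.

Fixpoint expr_val (d m : nat) (w : 'cV[R]_d -> R) (x : 'rV[R]_m) (e : expr) : C :=
  match e with
  | EConst t => aterm_val t
  | ESigma k => if insub k is Some k' then sigma x k' else 0
  | EAdd e1 e2 => expr_val w x e1 + expr_val w x e2
  | EMul e1 e2 => expr_val w x e1 * expr_val w x e2
  | EW es =>
      (w (\col_(i < d) complex.Re (nth 0 [seq expr_val w x e | e <- es] i)))%:C%C
  end.

(* This is continuous in x as soon as w is continuous. *)
Definition expr_fun (d m : nat) (e : expr) (w : 'cV[R]_d -> R) (x : 'rV[R]_m) : R :=
  complex.Re (expr_val w x e).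

(* The integral over T^m with respect to dx_1 ... dx_m, as an iterated Lebesgue
   integral; it is only used for continuous integrands. *)
Fixpoint torus_integral (m : nat) : ('rV[R]_m -> R) -> R :=
  match m with
  | 0 => fun f => f 0
  | m'.+1 => fun f =>
      \int[lebesgue_measure]_(t in [set t : R | 0 <= t < 1])
        torus_integral (fun y : 'rV[R]_m' => f (row_mx (t%:M : 'rV[R]_1) y))
  end.

Definition orbit_point (d : nat) (M : 'M[rat]_d) (q : 'cV[rat]_d) (n : nat) : 'cV[R]_d :=
  map_mx ratr (M ^+ n *m q).

Definition payoff_average (d : nat) (w : 'cV[R]_d -> R) (M : 'M[rat]_d)
    (q : 'cV[rat]_d) (n : nat) : R :=
  n%:R^-1 * \sum_(0 <= k < n) w (orbit_point M q k).

Definition mean_payoff (d : nat) (w : 'cV[R]_d -> R) (M : 'M[rat]_d)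
    (q : 'cV[rat]_d) : R :=
  limn (payoff_average w M q).

Definition lrs_recurrence (K : set C) (u : nat -> C) (k : nat) (a : 'I_k -> C) : Prop :=
  [/\ (1 <= k)%N,
      forall i, K (a i)
    & forall n, u (n + k)%N = \sum_(i < k) a i * u (n + i)%N].

Definition minimal_recurrence (K : set C) (u : nat -> C) (k : nat) (a : 'I_k -> C) : Prop :=
  lrs_recurrence K u a /\
  forall (k' : nat) (a' : 'I_k' -> C), lrs_recurrence K u a' -> (k <= k')%N.

(* It depends only on u, except that the null sequence has several minimal
   recurrences, all of order 1. *)
Definition lrs_char_poly (K : set C) (u : nat -> C) (chi : {poly C}) : Prop :=
  exists (k : nat) (a : 'I_k -> C),
    minimal_recurrence K u a /\ chi = 'X^k - \sum_(i < k) a i *: 'X^i.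

Definition no_repeated_root (chi : {poly C}) : Prop :=
  forall z, ~~ (('X - z%:P) ^+ 2 %| chi).

(* v and w below are the modulus-1 part and the decaying part of the i-th
   coordinate of the orbit; lambda may contain other numbers of modulus 1 than
   the characteristic roots of the v's. *)
Definition spectral_set (d : nat) (M : 'M[rat]_d) (q : 'cV[rat]_d)
    (l : nat) (lambda : 'I_l -> C) : Prop :=
  (forall j, algebraic_number (lambda j) /\ `|lambda j| = 1) /\
  forall i : 'I_d, exists v w : nat -> R,
    [/\ forall n, orbit_point M q n i ord0 = v n + w n,
        exists chi, [/\ lrs_char_poly real_algebraic_number (fun n => (v n)%:C%C) chi,
                        no_repeated_root chi,
                        forall z, root chi z -> `|z| = 1
                      & forall z, root chi z -> exists j, lambda j = z]
      & exists chi, lrs_char_poly real_algebraic_number (fun n => (w n)%:C%C) chi /\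
                    forall z, root chi z -> `|z| < 1].

Definition frac_part (x : R) : R := x - (Num.floor x)%:~R.

(* Rp is the integer usually written R, the identifier R being taken by the
   reals. *)
Definition torus_parametrization (l : nat) (lambda : 'I_l -> C) (Rp m : nat)
    (theta : 'rV[R]_m) (p : 'I_l -> 'I_Rp -> mpoly m.*2 C) : Prop :=
  [/\ (0 < Rp)%N /\ (0 < m)%N,
      forall j, 0 <= theta ord0 j < 1,
      forall (c0 : rat) (c : 'I_m -> rat),
        ratr c0 + \sum_(j < m) ratr (c j) * theta ord0 j = 0 ->
        c0 = 0 /\ forall j, c j = 0,
      forall i r s, algebraic_number (mcoeff s (p i r))
    & forall (i : 'I_l) (r : 'I_Rp) (n : nat),
        lambda i ^+ (n * Rp + r) =
        meval (sigma (\row_j frac_part (n%:R * theta ord0 j))) (p i r)].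

End Semantics.

Definition enc_input (d : nat) (M : 'M[rat]_d) (q : 'cV[rat]_d) (l Rp m : nat)
    (lambda : 'I_l -> aterm) (p : 'I_l -> 'I_Rp -> polycode) : btree :=
  enc_seq id [:: enc_nat d; enc_mx M; enc_mx q; enc_nat l; enc_nat Rp; enc_nat m;
                 enc_fun enc_aterm lambda; enc_fun (enc_fun enc_polycode (n := Rp)) p].

(* Main.v *)
(** The vector M^n q splits into a part v n whose coordinates are combinations of
   powers of the numbers lambda_j and a part tending to 0.  The coefficients of
   these combinations are rational expressions in M, q and the lambda_j, in which
   every case distinction is replaced by 1 - a a^-1, equal to 1 if a = 0 and to 0
   otherwise, so a program can write them down without any arithmetic.  They come
   from the Arnoldi recursion: orthogonalizing q, M q, M^2 q, ... yields monic
   polynomials P_k with P_d(M) q = 0 in which lambda_j is at most a simple root,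
   and the lambda_j-component of q is Q(M) q / Q(lambda_j), with Q the quotient of
   P_d by X - lambda_j.  Along each residue class modulo R, v is a trigonometric
   polynomial evaluated at the multiples of theta, and Weyl's equidistribution
   theorem for functions that are uniform limits of trigonometric polynomials
   gives the mean payoff.  *)

Require Import Defs.
From HB Require Import structures.
From mathcomp Require Import all_boot all_order all_algebra.
From mathcomp Require Import all_classical all_reals all_analysis.
From mathcomp Require Import complex.
From mathcomp Require Import -(notations) mpoly.
From mathcomp Require Import measurable_realfun.
From mathcomp Require Import ring lra.

Set Implicit Arguments.
Unset Strict Implicit.
Unset Printing Implicit Defensive.

Import Order.TTheory GRing.Theory Num.Theory.
Import numFieldNormedType.Exports.

Local Open Scope classical_set_scope.
Local Open Scope ring_scope.

(** * Computable functions on encodings *)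

(** Equality of algebraic numbers is never decided, so the emitted terms must be right in all
    degenerate cases at once. The characteristic polynomial of M would not do: lambda_j may be a
    multiple root of it through Jordan blocks that q does not meet. The minimal polynomial of q
    would do, but its degree is not known to the program. Gram-Schmidt with 0^-1 = 0 removes the
    difficulty: once a vector vanishes, all later projections are trivial, and the factors X gained
    leave the order of the nonzero root lambda_j unchanged, so d steps are always safe. That the
    form is positive comes from the orbit being real. On the analytic side, the composite of w with
    trigonometric polynomials is reached without a density theorem: uniform limits of trigonometric
    polynomials are closed under sums, products and absolute values, hence under hat functions, and
    w is interpolated on a grid by products of hats. *)

Definition computes (A B : Type) (eA : A -> btree) (eB : B -> btree) (f : A -> B) :=
  exists p, forall a, run p (eA a) (eB (f a)).

(** List cells, constructor tags and pairs all become a [Node], so a tagged term or a heterogeneous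
    input list is, up to conversion, a nested pair. *)
Definition enc_pair (A B : Type) (eA : A -> btree) (eB : B -> btree) (x : A * B) :=
  Node (eA x.1) (eB x.2).

(** The tree [Leaf] closes the nested pair that encodes the input and is also the entry of a unary
    numeral read as a list of units. *)
Definition enc_unit (_ : unit) := Leaf.

Lemma tree_constructible (t : btree) : exists p, forall u, run p u t.
Proof.
elim: t => [|a [p pP] b [q qP]]; first by exists PLeaf => u; constructor.
by exists (PPair p q) => u; constructor.
Qed.

Section Closure.
Variables (G : Type) (eG : G -> btree).

Lemma computes_id : computes eG eG (fun x => x).
Proof. by exists PId => a; constructor. Qed.

Lemma computes_const (B : Type) (eB : B -> btree) (b : B) :
  computes eG eB (fun=> b).
Proof. by have [p pP] := tree_constructible (eB b); exists p. Qed.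

Lemma computes_comp (A B : Type) (eA : A -> btree) (eB : B -> btree) (g : A -> B)
    (f : G -> A) :
  computes eA eB g -> computes eG eA f -> computes eG eB (fun x => g (f x)).
Proof.
move=> [p pP] [q qP]; exists (PComp p q) => a.
exact: run_comp (qP a) (pP _).
Qed.

Variables (A B : Type) (eA : A -> btree) (eB : B -> btree).

Lemma computes_pair (f : G -> A) (g : G -> B) :
  computes eG eA f -> computes eG eB g ->
  computes eG (enc_pair eA eB) (fun x => (f x, g x)).
Proof.
by move=> [p pP] [q qP]; exists (PPair p q) => a; constructor.
Qed.

Lemma computes_fst (f : G -> A * B) :
  computes eG (enc_pair eA eB) f -> computes eG eA (fun x => (f x).1).
Proof.
by move=> [p pP]; exists (PComp PFst p) => a; apply: run_comp (pP a) _; constructor.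
Qed.

Lemma computes_snd (f : G -> A * B) :
  computes eG (enc_pair eA eB) f -> computes eG eB (fun x => (f x).2).
Proof.
by move=> [p pP]; exists (PComp PSnd p) => a; apply: run_comp (pP a) _; constructor.
Qed.

Lemma computes_cons (f : G -> A) (s : G -> seq A) :
  computes eG eA f -> computes eG (enc_seq eA) s ->
  computes eG (enc_seq eA) (fun x => f x :: s x).
Proof.
by move=> [p pP] [q qP]; exists (PPair p q) => a; constructor.
Qed.

(** [G] is a context: a branch with bound variables is a function on the context extended by them.
    Testing the tree of the list is enough, since only a nonempty list is a [Node]. *)
Lemma computes_match (s : G -> seq A) (g : G -> A -> seq A -> B) (h : G -> B) :
  computes eG (enc_seq eA) s ->
  computes (enc_pair eG (enc_pair eA (enc_seq eA))) eB (fun x => g x.1 x.2.1 x.2.2) ->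
  computes eG eB h ->
  computes eG eB (fun x => if s x is y :: t then g x y t else h x).
Proof.
move=> [p pP] [q qP] [r rP]; exists (PIf p (PComp q (PPair PId p)) r) => a.
have := pP a; case: (s a) => [|y t] sa.
  by apply: run_if_false sa _.
apply: run_if_true (sa) _; apply: (run_comp _ (qP (a, (y, t)))).
exact: run_pair (run_id _) sa.
Qed.

(* The loop runs on the tree of (context, accumulator, remaining list). *)
Lemma computes_foldl (s : G -> seq A) (z : G -> B) (f : G -> B -> A -> B) :
  computes eG (enc_seq eA) s -> computes eG eB z ->
  computes (enc_pair (enc_pair eG eB) eA) eB (fun x => f x.1.1 x.1.2 x.2) ->
  computes eG eB (fun x => foldl (f x) (z x) (s x)).
Proof.
move=> [p pP] [q qP] [r rP].
pose body := PPair (PPair (PComp PFst PFst)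
  (PComp r (PPair PFst (PComp PFst PSnd)))) (PComp PSnd PSnd).
pose state a b t := Node (Node (eG a) (eB b)) (enc_seq eA t).
have loop a t b : run (PWhile PSnd body) (state a b t) (state a (foldl (f a) b t) [::]).
  elim: t b => [|x t IH] b /=; first by apply: run_while_stop; constructor.
  apply: run_while_step; [by constructor| |exact: IH].
  apply: run_pair; last exact: run_comp (run_snd _ _) (run_snd _ _).
  apply: run_pair; first exact: run_comp (run_fst _ _) (run_fst _ _).
  apply: (run_comp _ (rP (a, b, x))); apply: run_pair; first exact: run_fst.
  exact: run_comp (run_snd _ _) (run_fst _ _).
exists (PComp (PComp PSnd PFst) (PComp (PWhile PSnd body) (PPair (PPair PId q) p))).
move=> a; have init := run_pair (run_pair (run_id _) (qP a)) (pP a).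
exact: run_comp (run_comp init (loop _ _ _)) (run_comp (run_fst _ _) (run_snd _ _)).
Qed.

End Closure.


Lemma eq_computes (G B : Type) (eG : G -> btree) (eB : B -> btree) (f g : G -> B) :
  f =1 g -> computes eG eB f -> computes eG eB g.
Proof. by move=> fg [p pP]; exists p => a; rewrite -fg. Qed.

Ltac computes_extra := fail.

(* Decomposes the body of the function syntactically; [computes_extra] is
   extended below with one case per operation already known to be computable. *)
Ltac computes_step :=
  lazymatch goal with
  | |- computes _ _ (fun x => x) => eapply computes_id
  | |- computes _ _ (@fst _ _) => eapply (@computes_fst _ _ _ _ _ _ (fun x => x))
  | |- computes _ _ (@snd _ _) => eapply (@computes_snd _ _ _ _ _ _ (fun x => x))
  | |- computes _ _ (fun=> ?b) => eapply computes_const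
  | |- computes _ _ (fun x => fst (@?f x)) => eapply (@computes_fst _ _ _ _ _ _ f)
  | |- computes _ _ (fun x => snd (@?f x)) => eapply (@computes_snd _ _ _ _ _ _ f)
  | |- computes _ _ (fun x => (@?f x, @?g x)) => eapply (@computes_pair _ _ _ _ _ _ f g)
  | |- computes _ _ (fun x => (@?f x) :: (@?s x)) => eapply (@computes_cons _ _ _ _ f s)
  | |- computes _ _ (fun x => foldl _ _ _) => eapply computes_foldl
  | |- computes _ _ (fun x => if _ is _ :: _ then _ else _) => eapply computes_match
  | |- _ => computes_extra
  end; cbn beta.

Ltac computes_tac := repeat (eassumption || computes_step).

Lemma computes_rev (G A : Type) (eG : G -> btree) (eA : A -> btree) (s : G -> seq A) :
  computes eG (enc_seq eA) s -> computes eG (enc_seq eA) (fun x => rev (s x)).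
Proof.
move=> sP; apply: (@eq_computes _ _ _ _ (fun x => foldl (fun t y => y :: t) [::] (s x))).
  by move=> x; rewrite /rev; elim: (s x) [::] => //= y t IH u; apply: IH.
by computes_tac.
Qed.

Lemma computes_foldr (G A B : Type) (eG : G -> btree) (eA : A -> btree)
    (eB : B -> btree) (s : G -> seq A) (z : G -> B) (f : G -> A -> B -> B) :
  computes eG (enc_seq eA) s -> computes eG eB z ->
  computes (enc_pair (enc_pair eG eB) eA) eB (fun x => f x.1.1 x.2 x.1.2) ->
  computes eG eB (fun x => foldr (f x) (z x) (s x)).
Proof.
move=> sP zP fP.
apply: (@eq_computes _ _ _ _ (fun x => foldl (fun b a => f x a b) (z x) (rev (s x)))).
  by move=> x; rewrite foldl_rev.
by apply: (computes_foldl (eA := eA)) => //; apply: computes_rev.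
Qed.

Section DerivedClosure.
Variables (G : Type) (eG : G -> btree) (A B : Type) (eA : A -> btree) (eB : B -> btree).

Lemma computes_map (f : G -> A -> B) (s : G -> seq A) :
  computes (enc_pair eG eA) eB (fun x => f x.1 x.2) ->
  computes eG (enc_seq eA) s -> computes eG (enc_seq eB) (fun x => map (f x) (s x)).
Proof.
move=> fP sP.
apply: (@eq_computes _ _ _ _ (fun x => foldr (fun y t => f x y :: t) [::] (s x))).
  by move=> x; elim: (s x) => //= y t ->.
apply: (computes_foldr (eA := eA)) => //; first exact: computes_const.
apply: computes_cons; last by computes_tac.
apply: (@computes_comp _ _ _ _ _ _ (fun x => f x.1 x.2) (fun x => (x.1.1, x.2)) fP).
by computes_tac.
Qed.

(** A loop traverses one list, so the other one travels in the accumulator and loses its head at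
    each step; the result is built in reverse. *)
Lemma computes_zip (s : G -> seq A) (t : G -> seq B) :
  computes eG (enc_seq eA) s -> computes eG (enc_seq eB) t ->
  computes eG (enc_seq (enc_pair eA eB)) (fun x => zip (s x) (t x)).
Proof.
move=> sP tP.
pose step (acc : seq (A * B) * seq B) a :=
  if acc.2 is b :: t' then ((a, b) :: acc.1, t') else acc.
apply: (@eq_computes _ _ _ _ (fun x => rev (foldl step ([::], t x) (s x)).1)).
  move=> x; rewrite -[zip _ _]revK; congr rev; rewrite -[rev (zip _ _)]cats0.
  elim: (s x) (t x) [::] => [|a s' IH] [|b t'] u //=.
    by elim: s' {IH} => //= a' s' ->.
  by rewrite IH rev_cons cat_rcons.
apply: computes_rev; apply: (computes_fst (eB := enc_seq eB)).
apply: (computes_foldl (eA := eA)) => //.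
  by apply: computes_pair => //; apply: computes_const.
by rewrite /step; computes_tac.
Qed.

(** The tree of a unary number is that of a list of units, so iterating is folding over it. *)
Lemma computes_iter (n : G -> nat) (z : G -> B) (f : G -> B -> B) :
  computes eG enc_nat n -> computes eG eB z ->
  computes (enc_pair eG eB) eB (fun x => f x.1 x.2) ->
  computes eG eB (fun x => iter (n x) (f x) (z x)).
Proof.
move=> nP zP fP.
apply: (@eq_computes _ _ _ _ (fun x => foldl (fun b (_ : unit) => f x b) (z x) (nseq (n x) tt))).
  by move=> x; elim: (n x) (z x) => //= k IH b; rewrite IH -iterSr.
have enc_natE k : enc_nat k = enc_seq enc_unit (nseq k tt).
  by elim: k => //= k; rewrite /enc_nat /= => ->.
apply: (computes_foldl (eA := enc_unit)) => //.
  by have [p pP] := nP; exists p => a; rewrite -enc_natE.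
apply: (@computes_comp _ _ _ _ _ _ (fun x => f x.1 x.2) (fun x => (x.1.1, x.1.2)) fP).
by computes_tac.
Qed.

End DerivedClosure.

Lemma computes_succ (G : Type) (eG : G -> btree) (n : G -> nat) :
  computes eG enc_nat n -> computes eG enc_nat (fun x => (n x).+1).
Proof.
move=> [p pP]; exists (PPair PLeaf p) => a.
exact: run_pair (run_leaf _) (pP a).
Qed.

Ltac computes_extra ::=
  lazymatch goal with
  | |- computes _ _ (fun x => rev _) => eapply computes_rev
  | |- computes _ _ (fun x => foldr _ _ _) => eapply computes_foldr
  | |- computes _ _ (fun x => map _ _) => eapply computes_map
  | |- computes _ _ (fun x => zip _ _) => eapply computes_zip
  | |- computes _ _ (fun x => iter _ _ _) => eapply computes_iter
  | |- computes _ _ (fun x => S _) => eapply computes_succ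
  end.

Lemma computes_double (G : Type) (eG : G -> btree) (n : G -> nat) :
  computes eG enc_nat n -> computes eG enc_nat (fun x => (n x).*2).
Proof.
move=> nP; apply: (@eq_computes _ _ _ _ (fun x => iter (n x) (fun k => k.+2) 0%N)).
  by move=> x; elim: (n x) => //= k ->.
by computes_tac.
Qed.

Lemma computes_iota0 (G : Type) (eG : G -> btree) (n : G -> nat) :
  computes eG enc_nat n -> computes eG (enc_seq enc_nat) (fun x => iota 0 (n x)).
Proof.
move=> nP; apply: (@eq_computes _ _ _ _
  (fun x => rev (iter (n x) (fun u => (u.1.+1, u.1 :: u.2)) (0%N, [::])).2)).
  move=> x; rewrite -[iota _ _]revK; congr rev.
  suff -> : iter (n x) (fun u => (u.1.+1, u.1 :: u.2)) (0%N, [::]) =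
            (n x, rev (iota 0 (n x))) by [].
  elim: (n x) => //= k ->.
  by rewrite -[in RHS](addn1 k) -[0%N :: _]/(iota 0 k.+1) -addn1 iotaD rev_cat.
by computes_tac.
Qed.

Lemma computes_nth (G A : Type) (eG : G -> btree) (eA : A -> btree) (d : A)
    (s : G -> seq A) (n : G -> nat) :
  computes eG (enc_seq eA) s -> computes eG enc_nat n ->
  computes eG eA (fun x => nth d (s x) (n x)).
Proof.
move=> sP nP.
apply: (@eq_computes _ _ _ _ (fun x =>
  if iter (n x) (fun t => if t is _ :: t' then t' else [::]) (s x) is y :: _
  then y else d)).
  move=> x; have -> : forall k, iter k (fun t => if t is _ :: t' then t' else [::]) (s x)
      = drop k (s x).
    elim=> [|k IH]; first by rewrite drop0.
    by rewrite iterS IH -addn1 addnC -drop_drop; case: (drop k _) => //= a t; rewrite drop0.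
  by rewrite -[n x in RHS]addn0 -nth_drop; case: drop.
by computes_tac.
Qed.

Ltac computes_algebra := fail.

Ltac computes_extra ::=
  lazymatch goal with
  | |- computes _ _ (fun x => rev _) => eapply computes_rev
  | |- computes _ _ (fun x => foldr _ _ _) => eapply computes_foldr
  | |- computes _ _ (fun x => map _ _) => eapply computes_map
  | |- computes _ _ (fun x => zip _ _) => eapply computes_zip
  | |- computes _ _ (fun x => iter _ _ _) => eapply computes_iter
  | |- computes _ _ (fun x => S _) => eapply computes_succ
  | |- computes _ _ (fun x => double _) => eapply computes_double
  | |- computes _ _ (fun x => iota 0 _) => eapply computes_iota0
  | |- computes _ _ (fun x => nth _ _ _) => eapply computes_nth
  | |- _ => computes_algebra
  end.

(** * The program *)

Definition asum (s : seq aterm) : aterm := foldr AAdd (ARat 0) s.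

Definition vadd (s t : seq aterm) : seq aterm := [seq AAdd x.1 x.2 | x <- zip s t].

Definition vscale (a : aterm) (s : seq aterm) : seq aterm := [seq AMul a x | x <- s].

Definition dot (s t : seq aterm) : aterm := asum [seq AMul x.1 x.2 | x <- zip s t].

Definition mulv (A : seq (seq aterm)) (v : seq aterm) : seq aterm :=
  [seq dot r v | r <- A].

(* 0^-1 = 0 turns "a = 0" into the term 1 - a a^-1, which is 1 or 0. *)
Definition is_zero (a : aterm) : aterm := AAdd (ARat 1) (AOpp (AMul a (AInv a))).

(* With respect to a number lambda, a state ((b, s), (alpha, delta)) stands for a
   polynomial P: b = P(M) q, alpha = P(lambda), s = Q(M) q and delta = Q(lambda),
   where Q is the quotient of P by X - lambda. *)
Definition state : Type := (seq aterm * seq aterm) * (aterm * aterm).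

Definition state_axpy (h : aterm) (x y : state) : state :=
  ((vadd x.1.1 (vscale h y.1.1), vadd x.1.2 (vscale h y.1.2)),
   (AAdd x.2.1 (AMul h y.2.1), AAdd x.2.2 (AMul h y.2.2))).

(** If P = (X - lam) Q + alpha, then X P = (X - lam) (P + lam Q) + lam alpha, and the new quotient
    takes the value alpha + lam delta at lam. *)
Definition state_mulX (A : seq (seq aterm)) (lam : aterm) (x : state) : state :=
  ((mulv A x.1.1, vadd x.1.1 (vscale lam x.1.2)),
   (AMul lam x.2.1, AAdd x.2.1 (AMul lam x.2.2))).

(** One Gram-Schmidt projection. When [dot y.1.1 y.1.1] is 0 the real vector is 0, and the
    convention 0^-1 = 0 leaves the values in x unchanged. *)
Definition state_project (x y : state) : state :=
  state_axpy (AOpp (AMul (dot x.1.1 y.1.1) (AInv (dot y.1.1 y.1.1)))) x y.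

Definition krylov_step (A : seq (seq aterm)) (lam : aterm) (L : seq state) : seq state :=
  if L is x :: _ then foldl state_project (state_mulX A lam x) L :: L else L.

(** The initial state is that of P = 1: quotient 0, value 1 at lambda. The newest state is kept at
    the head. *)
Definition krylov (d : nat) (A : seq (seq aterm)) (q : seq aterm) (lam : aterm) :
    seq state :=
  iter d (krylov_step A lam) [:: ((q, [seq ARat 0 | _ <- q]), (ARat 1, ARat 0))].

(** The factor [is_zero] gives 0 when lam is not a root of the last polynomial, hence is not a
    frequency of the orbit. *)
Definition spectral_coef (d : nat) (A : seq (seq aterm)) (q : seq aterm) (lam : aterm) :
    seq aterm :=
  if krylov d A q lam is x :: _
  then vscale (AMul (is_zero x.2.1) (AInv x.2.2)) x.1.2 else [::].

(** The numbers lambda_j may repeat; each copy receives the whole component, which is later divided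
    by the number of copies. *)
Definition multiplicity (lams : seq aterm) (lam : aterm) : aterm :=
  asum [seq is_zero (AAdd lam (AOpp mu)) | mu <- lams].

Definition spectral_coefs (d : nat) (A : seq (seq aterm)) (q : seq aterm)
    (lams : seq aterm) : seq (seq aterm) :=
  [seq vscale (AInv (multiplicity lams lam)) (spectral_coef d A q lam) | lam <- lams].

Definition expr_sum (s : seq expr) : expr := foldr EAdd (EConst (ARat 0)) s.

Definition monomial_expr (m : nat) (es : seq nat) : expr :=
  foldr EMul (EConst (ARat 1))
    [seq iter x.2 (EMul (ESigma x.1)) (EConst (ARat 1)) | x <- zip (iota 0 m.*2) es].

Definition poly_expr (m : nat) (c : polycode) : expr :=
  expr_sum [seq EMul (EConst t.1) (monomial_expr m t.2) | t <- c].

Definition coord_expr (m : nat) (coefs : seq (seq aterm)) (ps : seq (seq polycode))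
    (r i : nat) : expr :=
  expr_sum [seq EMul (EConst (nth (ARat 0) x.1 i)) (poly_expr m (nth [::] x.2 r))
       | x <- zip coefs ps].

(** 1/[Rp] is the inverse of a sum of [Rp] ones, which spares the program the conversion of a unary
    number to a rational. *)
Definition payoff_expr (d Rp m : nat) (coefs : seq (seq aterm))
    (ps : seq (seq polycode)) : expr :=
  EMul (EConst (AInv (asum [seq ARat 1 | _ <- iota 0 Rp])))
    (expr_sum [seq EW [seq coord_expr m coefs ps r i | i <- iota 0 d] | r <- iota 0 Rp]).

Definition aterm_of_rats (s : seq (seq rat)) : seq (seq aterm) :=
  [seq [seq ARat a | a <- t] | t <- s].

Definition input : Type :=
  nat * (seq (seq rat) * (seq (seq rat) *
    (nat * (nat * (nat * (seq aterm * (seq (seq polycode) * unit))))))).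

Definition enc_typed_input : input -> btree :=
  enc_pair enc_nat (enc_pair (enc_seq (enc_seq enc_rat)) (enc_pair (enc_seq (enc_seq enc_rat))
    (enc_pair enc_nat (enc_pair enc_nat (enc_pair enc_nat (enc_pair (enc_seq enc_aterm)
      (enc_pair (enc_seq (enc_seq enc_polycode)) enc_unit))))))).

(** [q] arrives as a matrix whose rows have one entry; [asum] turns each row into a term. *)
Definition build_expr (x : input) : expr :=
  payoff_expr x.1 x.2.2.2.2.1 x.2.2.2.2.2.1
    (spectral_coefs x.1 (aterm_of_rats x.2.1)
       [seq asum t | t <- aterm_of_rats x.2.2.1] x.2.2.2.2.2.2.1)
    x.2.2.2.2.2.2.2.1.

Section AlgebraClosure.
Variables (G : Type) (eG : G -> btree).

Lemma computes_ARat (f : G -> rat) :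
  computes eG enc_rat f -> computes eG enc_aterm (fun x => ARat (f x)).
Proof.
exact: (computes_pair (eA := enc_nat) (computes_const eG enc_nat 0%N)).
Qed.

Lemma computes_AOpp (f : G -> aterm) :
  computes eG enc_aterm f -> computes eG enc_aterm (fun x => AOpp (f x)).
Proof. exact: (computes_pair (eA := enc_nat) (computes_const eG enc_nat 3%N)). Qed.

Lemma computes_AInv (f : G -> aterm) :
  computes eG enc_aterm f -> computes eG enc_aterm (fun x => AInv (f x)).
Proof. exact: (computes_pair (eA := enc_nat) (computes_const eG enc_nat 5%N)). Qed.

Lemma computes_AAdd (f g : G -> aterm) :
  computes eG enc_aterm f -> computes eG enc_aterm g ->
  computes eG enc_aterm (fun x => AAdd (f x) (g x)).
Proof.
move=> fP gP; exact: (computes_pair (computes_const eG enc_nat 2%N) (computes_pair fP gP)).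
Qed.

Lemma computes_AMul (f g : G -> aterm) :
  computes eG enc_aterm f -> computes eG enc_aterm g ->
  computes eG enc_aterm (fun x => AMul (f x) (g x)).
Proof.
move=> fP gP; exact: (computes_pair (computes_const eG enc_nat 4%N) (computes_pair fP gP)).
Qed.

Lemma computes_EConst (f : G -> aterm) :
  computes eG enc_aterm f -> computes eG enc_expr (fun x => EConst (f x)).
Proof. exact: (computes_pair (eA := enc_nat) (computes_const eG enc_nat 0%N)). Qed.

Lemma computes_ESigma (f : G -> nat) :
  computes eG enc_nat f -> computes eG enc_expr (fun x => ESigma (f x)).
Proof. exact: (computes_pair (eA := enc_nat) (computes_const eG enc_nat 1%N)). Qed.

Lemma computes_EAdd (f g : G -> expr) :
  computes eG enc_expr f -> computes eG enc_expr g ->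
  computes eG enc_expr (fun x => EAdd (f x) (g x)).
Proof.
move=> fP gP; exact: (computes_pair (computes_const eG enc_nat 2%N) (computes_pair fP gP)).
Qed.

Lemma computes_EMul (f g : G -> expr) :
  computes eG enc_expr f -> computes eG enc_expr g ->
  computes eG enc_expr (fun x => EMul (f x) (g x)).
Proof.
move=> fP gP; exact: (computes_pair (computes_const eG enc_nat 3%N) (computes_pair fP gP)).
Qed.

Lemma computes_EW (f : G -> seq expr) :
  computes eG (enc_seq enc_expr) f -> computes eG enc_expr (fun x => EW (f x)).
Proof. exact: (computes_pair (eA := enc_nat) (computes_const eG enc_nat 4%N)). Qed.

End AlgebraClosure.

Ltac computes_algebra ::=
  lazymatch goal with
  | |- computes _ _ (fun x => ARat _) => eapply computes_ARat
  | |- computes _ _ (fun x => AOpp _) => eapply computes_AOpp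
  | |- computes _ _ (fun x => AInv _) => eapply computes_AInv
  | |- computes _ _ (fun x => AAdd _ _) => eapply computes_AAdd
  | |- computes _ _ (fun x => AMul _ _) => eapply computes_AMul
  | |- computes _ _ (fun x => EConst _) => eapply computes_EConst
  | |- computes _ _ (fun x => ESigma _) => eapply computes_ESigma
  | |- computes _ _ (fun x => EAdd _ _) => eapply computes_EAdd
  | |- computes _ _ (fun x => EMul _ _) => eapply computes_EMul
  | |- computes _ _ (fun x => EW _) => eapply computes_EW
  end.

Lemma computes_build_expr : computes enc_typed_input enc_expr build_expr.
Proof.
rewrite /enc_typed_input /build_expr /payoff_expr /coord_expr /poly_expr /monomial_expr.
rewrite /spectral_coefs /spectral_coef /krylov /krylov_step /state_project /state_mulX.
rewrite /multiplicity /state_axpy /is_zero /mulv /dot /vscale /vadd /asum /expr_sum.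
rewrite /aterm_of_rats /enc_polycode.
by computes_tac.
Qed.

(** * Polynomials acting on sequences by the shift *)

Section PolynomialAction.
Variable K : comNzRingType.
Implicit Types (P Q : {poly K}) (u v : nat -> K).

Definition pact P u (n : nat) : K := \sum_(i < size P) P`_i * u (n + i)%N.

Lemma pact_widen m P u n : (size P <= m)%N ->
  pact P u n = \sum_(i < m) P`_i * u (n + i)%N.
Proof.
move=> le; rewrite /pact (big_ord_widen m (fun i => P`_i * u (n + i)%N) le) big_mkcond.
by apply: eq_bigr => i _; case: ltnP => // ge; rewrite nth_default // mul0r.
Qed.

Lemma eq_pact P u v : u =1 v -> pact P u =1 pact P v.
Proof. by move=> uv n; apply: eq_bigr => i _; rewrite uv. Qed.

Lemma pactD P Q u n : pact (P + Q) u n = pact P u n + pact Q u n.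
Proof.
pose m := maxn (size P) (size Q).
rewrite (@pact_widen m) ?size_polyD // (@pact_widen m P) ?leq_maxl //.
rewrite (@pact_widen m Q) ?leq_maxr // -big_split /=.
by apply: eq_bigr => i _; rewrite coefD mulrDl.
Qed.

Lemma pactZ a P u n : pact (a *: P) u n = a * pact P u n.
Proof.
rewrite (@pact_widen (size P)) ?size_scale_leq // mulr_sumr.
by apply: eq_bigr => i _; rewrite coefZ mulrA.
Qed.

Lemma pactC a u n : pact a%:P u n = a * u n.
Proof.
by rewrite (@pact_widen 1) ?size_polyC_leq1 // big_ord1 coefC addn0.
Qed.

Lemma pactX P u n : pact ('X * P) u n = pact P u n.+1.
Proof.
rewrite (@pact_widen (size P).+1); last first.
  by rewrite (leq_trans (size_polyMleq _ _)) // size_polyX.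
rewrite big_ord_recl coefXM mul0r add0r.
by apply: eq_bigr => i _; rewrite coefXM /= addnS.
Qed.

(** The sequences become a module over K[X], so recurrences are handled by polynomial algebra. *)
Lemma pactM P Q u n : pact (P * Q) u n = pact P (pact Q u) n.
Proof.
elim/poly_ind: P n => [|P c IH] n.
  by rewrite mul0r /pact size_poly0 !big_ord0.
rewrite mulrDl !pactD [P * 'X]mulrC -mulrA !pactX IH.
by rewrite mul_polyC pactZ pactC.
Qed.

Lemma pact_add P u v n : pact P (fun k => u k + v k) n = pact P u n + pact P v n.
Proof. by rewrite -big_split; apply: eq_bigr => i _; rewrite mulrDr. Qed.

Lemma pact_scale P a u n : pact P (fun k => a * u k) n = a * pact P u n.
Proof. by rewrite mulr_sumr; apply: eq_bigr => i _; rewrite mulrCA. Qed.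

Lemma pact_sum (I : Type) (r : seq I) P (u : I -> nat -> K) n :
  pact P (fun k => \sum_(i <- r) u i k) n = \sum_(i <- r) pact P (u i) n.
Proof.
by rewrite exchange_big; apply: eq_bigr => i _; rewrite mulr_sumr.
Qed.

Lemma pact0 P u n : (forall k, u k = 0) -> pact P u n = 0.
Proof. by move=> u0; apply: big1 => i _; rewrite u0 mulr0. Qed.

Lemma pact_geometric P a z n : pact P (fun k => a * z ^+ k) n = a * (P.[z] * z ^+ n).
Proof.
rewrite pact_scale horner_coef mulr_suml; congr (_ * _); apply: eq_bigr => i _.
by rewrite exprD -mulrA [z ^+ n * _]mulrC.
Qed.

Lemma pactN P u n : pact (- P) u n = - pact P u n.
Proof. by rewrite -scaleN1r pactZ mulN1r. Qed.

Lemma pactXn k u n : pact 'X^k u n = u (n + k)%N.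
Proof.
elim: k n => [|k IH] n; first by rewrite expr0 pactC mul1r addn0.
by rewrite exprS pactX IH addSnnS.
Qed.

Lemma pact_polysum (I : Type) (r : seq I) (P : I -> {poly K}) u n :
  pact (\sum_(i <- r) P i) u n = \sum_(i <- r) pact (P i) u n.
Proof.
elim: r => [|i r IH]; last by rewrite !big_cons pactD IH.
by rewrite !big_nil /pact size_poly0 big_ord0.
Qed.

Lemma pact_subX z u n : pact ('X - z%:P) u n = u n.+1 - z * u n.
Proof.
by rewrite pactD -['X]mulr1 pactX -polyCN !pactC mul1r mulNr.
Qed.

End PolynomialAction.

(** * Orthogonal polynomials of a real orbit *)

Section GramSchmidt.
Variables (K : numFieldType) (d : nat) (u : 'I_d -> nat -> K).
Implicit Types (P Q x y : {poly K}) (L : seq {poly K}).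

(** For u i n = (M^n q)_i this is the dot product of P(M) q and Q(M) q; it is bilinear and not
    Hermitian because all data are real. *)
Definition form P Q : K := \sum_i pact P (u i) 0 * pact Q (u i) 0.

Definition project x y := x + (- (form x y * (form y y)^-1)) *: y.

Definition gram_schmidt (k : nat) : seq {poly K} :=
  iter k (fun L => if L is x :: _ then foldl project ('X * x) L :: L else L) [:: 1].

Definition ortho_poly (k : nat) : {poly K} := head 0 (gram_schmidt k).

Local Notation P_ := ortho_poly.

Lemma formC x y : form x y = form y x.
Proof. by apply: eq_bigr => i _; rewrite mulrC. Qed.

Lemma formDl x y z : form (x + y) z = form x z + form y z.
Proof. by rewrite -big_split; apply: eq_bigr => i _; rewrite pactD mulrDl. Qed.

Lemma formZl a x z : form (a *: x) z = a * form x z.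
Proof. by rewrite mulr_sumr; apply: eq_bigr => i _; rewrite pactZ mulrA. Qed.

Lemma form0l x z : (forall i, pact x (u i) 0 = 0) -> form x z = 0.
Proof. by move=> x0; apply: big1 => i _; rewrite x0 mul0r. Qed.

Lemma gram_schmidtE k :
  gram_schmidt k.+1 = foldl project ('X * P_ k) (gram_schmidt k) :: gram_schmidt k.
Proof.
have : gram_schmidt k != [::] by elim: k => // k; rewrite /gram_schmidt /=; case: (iter k _ _).
by rewrite /P_ /gram_schmidt /=; case: (iter k _ _).
Qed.

Lemma gram_schmidtS k : gram_schmidt k.+1 = P_ k.+1 :: gram_schmidt k.
Proof. by rewrite /P_ gram_schmidtE. Qed.

Lemma ortho_polyS k : P_ k.+1 = foldl project ('X * P_ k) (gram_schmidt k).
Proof. by rewrite /P_ gram_schmidtE. Qed.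

Lemma mem_gram_schmidt j k : (j <= k)%N -> P_ j \in gram_schmidt k.
Proof.
elim: k => [|k IH]; first by rewrite leqn0 => /eqP ->; rewrite inE.
rewrite gram_schmidtS inE leq_eqVlt => /predU1P[->|]; first by rewrite eqxx.
by rewrite ltnS => /IH ->; rewrite orbT.
Qed.

Lemma gram_schmidtP k x : x \in gram_schmidt k -> exists2 j, (j <= k)%N & x = P_ j.
Proof.
elim: k => [|k IH]; first by rewrite inE => /eqP ->; exists 0.
rewrite gram_schmidtS inE => /predU1P[->|/IH[j jk ->]]; first by exists k.+1.
by exists j => //; apply: leqW.
Qed.

Lemma foldl_project_monic n L x : x \is monic -> size x = n.+1 ->
  all (fun y => size y <= n)%N L ->
  foldl project x L \is monic /\ size (foldl project x L) = n.+1.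
Proof.
elim: L x => //= y L IH x xm xs /andP[ys Ls]; apply: IH => //.
  rewrite monicE lead_coefDl ?(eqP xm) // xs ltnS.
  exact: leq_trans (size_scale_leq _ _) ys.
by rewrite size_polyDl xs // ltnS (leq_trans (size_scale_leq _ _)).
Qed.

Lemma ortho_poly_monic k : P_ k \is monic /\ size (P_ k) = k.+1.
Proof.
elim/ltn_ind: k => -[|k] IH; first by rewrite /P_ monic1 size_poly1.
have [Pm Ps] := IH k (ltnSn k).
rewrite ortho_polyS; apply: foldl_project_monic.
- by rewrite monicMl ?monicX.
- by rewrite mulrC size_mulX ?Ps // -size_poly_eq0 Ps.
by apply/allP => y /gram_schmidtP[j jk ->]; rewrite (IH j _).2.
Qed.

Lemma foldl_project_orth L x y : (forall z, z \in L -> form z y = 0) ->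
  form (foldl project x L) y = form x y.
Proof.
elim: L x => //= z L IH x Ly; rewrite IH; last by move=> t tL; apply: Ly; rewrite inE tL orbT.
by rewrite formDl formZl [form z y]Ly ?mulr0 ?addr0 // inE eqxx.
Qed.

Hypothesis u_real : forall i n, u i n \is Num.real.

Definition real_coefs P := forall i, P`_i \is Num.real.

(** A sum of squares of real numbers vanishes only termwise; without realness the bilinear form
    could have isotropic vectors. *)
Lemma form_eq0 x : real_coefs x -> form x x = 0 -> forall i, pact x (u i) 0 = 0.
Proof.
move=> xr /eqP; rewrite psumr_eq0.
  by move=> /allP x0 i; have := x0 i (mem_index_enum _); rewrite -expr2 sqrf_eq0 => /eqP.
move=> i _; rewrite -expr2 real_exprn_even_ge0 //.
by apply: rpred_sum => j _; rewrite rpredM.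
Qed.

Lemma form_real x y : real_coefs x -> real_coefs y -> form x y \is Num.real.
Proof.
move=> xr yr.
by apply: rpred_sum => i _; apply: rpredM; apply: rpred_sum => j _; rewrite rpredM.
Qed.

Lemma foldl_project_real L x : real_coefs x -> {in L, forall y, real_coefs y} ->
  real_coefs (foldl project x L).
Proof.
elim: L x => //= y L IH x xr Lr; apply: IH; last first.
  by move=> z zL; apply: Lr; rewrite inE zL orbT.
have yr : real_coefs y by apply: Lr; rewrite inE eqxx.
move=> i; rewrite coefD coefZ rpredD // rpredM // rpredN rpredM ?form_real //.
by rewrite rpredV form_real.
Qed.

Lemma ortho_poly_real k : real_coefs (P_ k).
Proof.
elim/ltn_ind: k => -[|k] IH; first by move=> i; rewrite /P_ /= coef1 rpred_nat.
rewrite ortho_polyS; apply: foldl_project_real.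
  by move=> i; rewrite coefXM; case: eqP => // _; apply: IH.
by move=> y /gram_schmidtP[j jk ->]; apply: IH.
Qed.

(** Later projections keep the orthogonality already gained, L being pairwise orthogonal. If form y
    y = 0 then y gives the zero vector and is orthogonal to everything, so the value 0^-1 = 0 does
    no harm. *)
Lemma foldl_project_orthogonal L x y :
  {in L, forall y, real_coefs y} ->
  pairwise (fun y z => form y z == 0) L ->
  y \in L -> form (foldl project x L) y = 0.
Proof.
elim: L x => //= z L IH x Lr /andP[zL Lp]; rewrite inE => /predU1P[->|]; last first.
  by apply: IH => // t tL; apply: Lr; rewrite inE tL orbT.
rewrite foldl_project_orth; last first.
  by move=> t tL; rewrite formC; apply/eqP/(allP zL).
rewrite formDl formZl; have [z0|z0] := eqVneq (form z z) 0.
  rewrite formC form0l ?mul0r ?oppr0 ?mul0r ?addr0 //; apply: form_eq0 => //.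
  by apply: Lr; rewrite inE eqxx.
by rewrite mulNr mulfVK // subrr.
Qed.

Lemma gram_schmidt_real k : {in gram_schmidt k, forall y, real_coefs y}.
Proof. by move=> y /gram_schmidtP[j jk ->]; apply: ortho_poly_real. Qed.

Lemma gram_schmidt_pairwise k : pairwise (fun y z => form y z == 0) (gram_schmidt k).
Proof.
elim: k => // k IH; rewrite gram_schmidtE /= IH andbT.
apply/allP => y yk; apply/eqP; apply: foldl_project_orthogonal => //.
exact: gram_schmidt_real.
Qed.

(** The P_j with j < k span the polynomials of degree less than k; the induction removes the leading
    term of y by a multiple of the P_j of the same degree. *)
Lemma ortho_poly_orthogonal k y : (size y <= k)%N -> form (P_ k) y = 0.
Proof.
move=> yk; have : (size y <= k)%N /\ (k <= k)%N by [].
move: {1 2}k => j; elim: j y {yk} => [|j IH] y [].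
  rewrite leqn0 size_poly_eq0 => /eqP -> _.
  by rewrite formC form0l // => i; rewrite /pact size_poly0 big_ord0.
move=> yj jk; have [Pm Ps] := ortho_poly_monic j.
have -> : y = y`_j *: P_ j + (y - y`_j *: P_ j) by rewrite addrC subrK.
rewrite formC formDl formZl ![form _ (P_ k)]formC [form _ (y - _)]IH.
  case: k IH jk => [|k] _; rewrite ?ltn0 // => jk.
  rewrite ortho_polyS foldl_project_orthogonal ?mulr0 ?addr0 //.
  - exact: gram_schmidt_real.
  - exact: gram_schmidt_pairwise.
  - exact: mem_gram_schmidt.
split; last exact: ltnW.
apply/leq_sizeP => i; rewrite leq_eqVlt coefB coefZ => /predU1P[<-|ji].
  by move: Pm; rewrite monicE /lead_coef Ps => /eqP ->; rewrite mulr1 subrr.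
by rewrite [y`_i]nth_default ?(leq_trans yj) // [_`_i]nth_default ?Ps // mulr0 subr0.
Qed.

(** P_d - chi has degree less than d, so it is orthogonal to P_d; since chi gives the zero vector,
    form P_d P_d = 0. *)
Lemma ortho_poly_annihilates (chi : {poly K}) : chi \is monic -> size chi = d.+1 ->
  (forall i, pact chi (u i) 0 = 0) -> forall i, pact (P_ d) (u i) 0 = 0.
Proof.
move=> cm cs c0; apply: form_eq0; first exact: ortho_poly_real.
have [Pm Ps] := ortho_poly_monic d.
have {2}-> : P_ d = chi + (P_ d - chi) by rewrite addrC subrK.
rewrite formC formDl form0l // add0r formC ortho_poly_orthogonal //.
apply/leq_sizeP => i; rewrite leq_eqVlt coefB => /predU1P[<-|ji].
  by move: Pm cm; rewrite !monicE /lead_coef Ps cs => /eqP -> /eqP ->; rewrite subrr.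
by rewrite !nth_default ?subr0 ?Ps ?cs.
Qed.

Hypothesis u_stable : forall P, (forall i, pact P (u i) 0 = 0) ->
  forall i n, pact P (u i) n = 0.

(** X P_k gives the zero vector too, so all its projection coefficients are 0. *)
Lemma ortho_poly_mulX k : (forall i, pact (P_ k) (u i) 0 = 0) -> P_ k.+1 = 'X * P_ k.
Proof.
move=> P0; rewrite ortho_polyS.
have XP0 y : form ('X * P_ k) y = 0 by apply: form0l => i; rewrite pactX u_stable.
by elim: (gram_schmidt k) => //= y L IH; rewrite /project XP0 mul0r oppr0 scale0r addr0.
Qed.

(* At the first k at which P_ k kills u, P_ k is the minimal polynomial of u, so
   lam is at most a simple root because (X - lam) h kills u; from then on the
   recursion only multiplies by X. *)
Lemma ortho_poly_simple_root (Q h : {poly K}) (lam : K) :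
  (forall i, pact (P_ d) (u i) 0 = 0) -> lam != 0 -> h.[lam] != 0 ->
  (forall i n, pact (('X - lam%:P) * h) (u i) n = 0) ->
  P_ d = ('X - lam%:P) * Q -> Q.[lam] != 0.
Proof.
move=> Pd0 lam0 hlam hu PQ; apply/negP => /eqP Qlam.
pose Z k := [forall i, pact (P_ k) (u i) 0 == 0].
have exZ : exists k, Z k by exists d; apply/forallP => i; rewrite Pd0.
have [k /forallP Zk kmin] := ex_minnP exZ.
have Pk0 i : pact (P_ k) (u i) 0 = 0 by apply/eqP/Zk.
have kd : (k <= d)%N by apply: kmin; apply/forallP => i; rewrite Pd0.
have PX j : P_ (k + j) = 'X^j * P_ k /\ forall i, pact (P_ (k + j)) (u i) 0 = 0.
  elim: j => [|j [IH IH0]]; first by rewrite addn0 expr0 mul1r.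
  rewrite addnS ortho_poly_mulX // IH exprS mulrA; split=> // i.
  by rewrite -mulrA -IH pactX u_stable.
have [Pdk _] := PX (d - k)%N; rewrite subnKC // in Pdk.
(* lam is nonzero, so the factor X^(d-k) is prime to X - lam and the double root already belongs to
   P_k. *)
have dvd2 : ('X - lam%:P) ^+ 2 %| P_ k.
  have : ('X - lam%:P) ^+ 2 %| 'X^(d - k) * P_ k.
    rewrite -Pdk PQ expr2 dvdp_mul2l ?polyXsubC_eq0 // dvdp_XsubCl.
    exact/rootP.
  rewrite Gauss_dvdpr //; apply: coprimep_expl; apply: coprimep_expr.
  by rewrite coprimep_sym coprimep_XsubC /root hornerX.
move: dvd2; rewrite expr2 => /dvdpP[Q2 PQ2].
pose F := ('X - lam%:P) * Q2.
have FP : P_ k = ('X - lam%:P) * F by rewrite PQ2 /F; ring.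
have Fu i n : pact F (u i) n = 0.
  (* F u is geometric of ratio lam, and h F u = 0 with h(lam) <> 0. *)
  have geo m : pact F (u i) m = pact F (u i) 0 * lam ^+ m.
    elim: m => [|m IH]; first by rewrite expr0 mulr1.
    have : pact (P_ k) (u i) m = 0 by apply: u_stable.
    rewrite FP pactM pact_subX => /eqP; rewrite subr_eq0 => /eqP ->.
    by rewrite IH exprS mulrCA.
  have : pact (h * F) (u i) 0 = 0.
    have -> : h * F = Q2 * (('X - lam%:P) * h) by rewrite /F; ring.
    by rewrite pactM pact0.
  rewrite pactM (eq_pact _ geo) pact_geometric expr0 mulr1 => /eqP.
  by rewrite mulf_eq0 (negPf hlam) orbF => /eqP F00; rewrite geo F00 mul0r.
have [Pm Ps] := ortho_poly_monic k.
have F0 : F != 0.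
  by apply: contraTneq Pm => F0; rewrite FP F0 mulr0 monicE lead_coef0 eq_sym oner_eq0.
have Fs : size F = k.
  by apply/succn_inj; rewrite -Ps FP mulrC [RHS]size_Mmonic ?monicXsubC // size_XsubC addn2.
case: k Fs Ps Pm FP kmin {Zk Pk0 kd PX Pdk PQ2} => [|k] Fs Ps Pm FP kmin.
  by move: F0; rewrite -size_poly_eq0 Fs.
have Fm : F \is monic by move: Pm; rewrite FP monicMl ?monicXsubC.
have [Pm' Ps'] := ortho_poly_monic k.
(* F is monic of degree k and kills u, so by orthogonality P_k already gives the zero vector, one
   index before the supposed first one. *)
suff : Z k by move/kmin; rewrite ltnn.
apply/forallP => i; apply/eqP; move: i; apply: form_eq0; first exact: ortho_poly_real.
have {2}-> : P_ k = F + (P_ k - F) by rewrite addrC subrK.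
rewrite formC formDl form0l ?add0r // formC ortho_poly_orthogonal //.
apply/leq_sizeP => i; rewrite leq_eqVlt coefB => /predU1P[<-|ji].
  by move: Fm Pm'; rewrite !monicE /lead_coef Fs Ps' => /eqP -> /eqP ->; rewrite subrr.
by rewrite !nth_default ?subr0 ?Ps' ?Fs.
Qed.

End GramSchmidt.

Lemma distinct_roots_closed_form (K : fieldType) (s : seq K) (v : nat -> K) :
  uniq s -> (forall n, pact (\prod_(z <- s) ('X - z%:P)) v n = 0) ->
  exists c : K -> K, forall n, v n = \sum_(z <- s) c z * z ^+ n.
Proof.
elim: s v => [|z s IH] v /=.
  move=> _ v0; exists (fun=> 0) => n; rewrite big_nil -[RHS](v0 n) big_nil.
  by rewrite -[v n]mul1r -pactC.
move=> /andP[zs us] v0.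
have [|c cP] := IH (pact ('X - z%:P) v) us.
  by move=> n; rewrite -pactM mulrC -(v0 n) big_cons.
(* The shift minus z multiplies t^n by t - z, so these coefficients account for
   [pact ('X - z%:P) v]; the difference [x] is then geometric of ratio z. *)
pose b t := c t / (t - z).
pose x n := v n - \sum_(t <- s) b t * t ^+ n.
have xE n : x n = x 0 * z ^+ n.
  elim: n => [|n IHn]; first by rewrite expr0 mulr1.
  have cS : \sum_(t <- s) b t * t ^+ n.+1 =
      \sum_(t <- s) c t * t ^+ n + z * \sum_(t <- s) b t * t ^+ n.
    rewrite mulr_sumr -big_split; apply: eq_big_seq => t ts /=.
    have tz : t - z != 0 by rewrite subr_eq0; apply: contraNneq zs => <-.
    by rewrite /b exprS; field.
  rewrite exprS mulrCA -IHn /x cS -cP pact_subX; ring.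
exists (fun t => if t == z then x 0 else b t) => n.
rewrite big_cons eqxx -xE /x -[LHS](subrK (\sum_(t <- s) b t * t ^+ n)); congr (_ + _).
by apply: eq_big_seq => t ts; case: eqVneq => // tz; rewrite -tz ts in zs.
Qed.

Section Krylov.
Variables (K : fieldType) (d : nat) (M : 'M[K]_d) (q : 'cV[K]_d).

Let u (i : 'I_d) (n : nat) : K := (M ^+ n *m q) i ord0.

Lemma krylov_shift i n k : u i (n + k)%N = \sum_j (M ^+ n) i j * u j k.
Proof. by rewrite /u exprD -mulmxA mxE. Qed.

Lemma krylov_stable (P : {poly K}) : (forall i, pact P (u i) 0 = 0) ->
  forall i n, pact P (u i) n = 0.
Proof.
move=> P0 i n; rewrite /pact.
under eq_bigr => k _ do rewrite krylov_shift mulr_sumr.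
rewrite exchange_big big1 //= => j _.
transitivity ((M ^+ n) i j * pact P (u j) 0); last by rewrite P0 mulr0.
by rewrite /pact mulr_sumr; apply: eq_bigr => k _; rewrite mulrCA add0n.
Qed.

Lemma pact_krylovS (P : {poly K}) i : pact P (u i) 1 = \sum_j M i j * pact P (u j) 0.
Proof.
rewrite /pact; under eq_bigr => k _ do rewrite krylov_shift mulr_sumr expr1.
rewrite exchange_big; apply: eq_bigr => j _; rewrite /= mulr_sumr.
by apply: eq_bigr => k _; rewrite mulrCA add0n.
Qed.

Lemma pact_char_poly i : pact (char_poly M) (u i) 0 = 0.
Proof.
rewrite /u; case: d M q i => [|d'] A x i; first by case: i.
have <- : (horner_mx A (char_poly A) *m x) i ord0 = 0 by rewrite Cayley_Hamilton mul0mx mxE.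
rewrite /horner_mx /horner_morph (horner_coef_wide _ (size_poly _ _)).
rewrite mulmx_suml summxE; apply: eq_bigr => k _.
by rewrite coef_map /= -mulmxE -mulmxA mul_scalar_mx [RHS]mxE.
Qed.

End Krylov.

(** * Correctness of the computed coefficients *)

Section SpectralCoefficients.
Variable R : realType.
Local Notation K := R[i].
Local Notation val := (aterm_val R).

Lemma val_asum (s : seq aterm) : val (asum s) = \sum_(a <- s) val a.
Proof. by elim: s => [|a s IH]; rewrite ?big_nil ?big_cons /= ?rmorph0 // IH. Qed.

Lemma val_is_zero (a : aterm) : val (is_zero a) = (val a == 0)%:R.
Proof.
rewrite /is_zero /= rmorph1; have [->|a0] := eqVneq (val a) 0; first by rewrite mul0r subr0.
by rewrite mulfV // subrr.
Qed.

Definition reps d (s : seq aterm) (x : 'I_d -> K) :=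
  size s = d /\ forall i : 'I_d, val (nth (ARat 0) s i) = x i.

Lemma reps_eq d s (x y : 'I_d -> K) : x =1 y -> reps s x -> reps s y.
Proof. by move=> xy [ss sx]; split=> // i; rewrite sx. Qed.

Lemma reps_vadd d s t (x y : 'I_d -> K) : reps s x -> reps t y ->
  reps (vadd s t) (fun i => x i + y i).
Proof.
move=> [ss sx] [ts ty]; have zs : size (zip s t) = d by rewrite size_zip ss ts minnn.
split; first by rewrite size_map.
by move=> i; rewrite (nth_map (ARat 0, ARat 0)) ?zs // nth_zip ?ss //= sx ty.
Qed.

Lemma reps_vscale d a s (x : 'I_d -> K) : reps s x ->
  reps (vscale a s) (fun i => val a * x i).
Proof.
move=> [ss sx]; split; first by rewrite size_map.
by move=> i; rewrite (nth_map (ARat 0)) ?ss //= sx.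
Qed.

Lemma val_dot d s t (x y : 'I_d -> K) : reps s x -> reps t y ->
  val (dot s t) = \sum_i x i * y i.
Proof.
move=> [ss sx] [ts ty]; have zs : size (zip s t) = d by rewrite size_zip ss ts minnn.
rewrite val_asum big_map (big_nth (ARat 0, ARat 0)) zs big_mkord.
by apply: eq_bigr => i _; rewrite nth_zip ?ss //= sx ty.
Qed.

Variables (d : nat) (A : seq (seq aterm)) (qa : seq aterm).
Variables (M : 'M[K]_d) (q : 'cV[K]_d).
Hypothesis sizeA : size A = d.
Hypothesis A_M : forall i : 'I_d, reps (nth [::] A i) (M i).
Hypothesis qa_q : reps qa (fun i => q i ord0).

Let u (i : 'I_d) (n : nat) : K := (M ^+ n *m q) i ord0.

Lemma reps_mulv s (x : 'I_d -> K) : reps s x ->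
  reps (mulv A s) (fun i => \sum_j M i j * x j).
Proof.
move=> sx; split; first by rewrite size_map.
move=> i; rewrite (nth_map [::]) ?sizeA //; exact: val_dot.
Qed.

Definition tracks (lam : K) (P : {poly K}) (x : state) :=
  exists Q : {poly K},
    [/\ reps x.1.1 (fun i => pact P (u i) 0), P = ('X - lam%:P) * Q + (val x.2.1)%:P,
        reps x.1.2 (fun i => pact Q (u i) 0) & val x.2.2 = Q.[lam]].

Lemma tracks_axpy lam h P P' x y : tracks lam P x -> tracks lam P' y ->
  tracks lam (P + val h *: P') (state_axpy h x y).
Proof.
move=> [Q [xP PQ xQ xl]] [Q' [yP PQ' yQ yl]]; exists (Q + val h *: Q'); split.
- apply: reps_eq (reps_vadd xP (reps_vscale h yP)) => i.
  by rewrite pactD pactZ.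
- rewrite {1}PQ {1}PQ' /= polyCD polyCM -!mul_polyC; ring.
- by apply: reps_eq (reps_vadd xQ (reps_vscale h yQ)) => i; rewrite pactD pactZ.
- by rewrite /= xl yl hornerD hornerZ.
Qed.

Lemma tracks_mulX a P x : tracks (val a) P x ->
  tracks (val a) ('X * P) (state_mulX A a x).
Proof.
move=> [Q [xP PQ xQ xl]]; exists (P + val a *: Q); split.
- apply: reps_eq (reps_mulv xP) => i; rewrite pactX; exact/esym/pact_krylovS.
- rewrite /= {1 2}PQ polyCM -!mul_polyC; ring.
- by apply: reps_eq (reps_vadd xP (reps_vscale a xQ)) => i; rewrite pactD pactZ.
- rewrite /= xl hornerD hornerZ {1}PQ !hornerE; ring.
Qed.

Lemma tracks_project lam P P' x y : tracks lam P x -> tracks lam P' y ->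
  tracks lam (project u P P') (state_project x y).
Proof.
move=> xP yP; have [_ [xb _ _ _]] := xP; have [_ [yb _ _ _]] := yP.
suff -> : project u P P' = P + val (AOpp (AMul (dot x.1.1 y.1.1)
    (AInv (dot y.1.1 y.1.1)))) *: P' by apply: tracks_axpy.
by rewrite /project /= (val_dot xb yb) (val_dot yb yb).
Qed.

Lemma tracks_foldl lam L L' P x :
  List.Forall2 (tracks lam) L L' -> tracks lam P x ->
  tracks lam (foldl (project u) P L) (foldl state_project x L').
Proof.
move=> LL'; elim: LL' P x => //= P' x' L1 L2 Px' _ IH P x Px.
by apply: IH; apply: tracks_project.
Qed.

(** The projection coefficients involve only the vectors, not lambda, so the states of every lambda
    follow the same polynomials. *)
Lemma krylov_tracks a k :
  List.Forall2 (tracks (val a)) (gram_schmidt u k) (krylov k A qa a).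
Proof.
elim: k => [|k IH].
  constructor; last by constructor.
  exists 0; split=> /=.
  - by apply: reps_eq qa_q => i; rewrite pactC mul1r /u expr0 mul1mx.
  - by rewrite mulr0 add0r rmorph1.
  - have [qs _] := qa_q; split; first by rewrite size_map.
    move=> i; rewrite (nth_map (ARat 0)) ?qs //= rmorph0.
    by rewrite /pact size_poly0 big_ord0.
  - by rewrite rmorph0 horner0.
rewrite /krylov /gram_schmidt !iterS -/(gram_schmidt u k) -/(krylov k A qa a).
case: IH => [|P x L L' Px LL'] /=; first by constructor.
have LLx : List.Forall2 (tracks (val a)) (P :: L) (x :: L') by constructor.
by constructor => //; apply: tracks_foldl => //; apply: tracks_project => //; apply: tracks_mulX.
Qed.

Hypothesis u_real : forall i n, u i n \is Num.real.

(* The coefficient c i of lambda^n in u i n is recovered from P = (X - lambda) Q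
   + alpha, which kills u: if alpha <> 0 it is 0, and otherwise applying h Q to
   u i, where h kills rest i and h(lambda) <> 0, gives (Q u i)_0 = c i Q(lambda). *)
Lemma reps_spectral_coef a (c : 'I_d -> K) (rest : 'I_d -> nat -> K)
    (h : 'I_d -> {poly K}) :
  val a != 0 ->
  (forall i n, u i n = c i * val a ^+ n + rest i n) ->
  (forall i, (h i).[val a] != 0) ->
  (forall i n, pact (h i) (rest i) n = 0) ->
  reps (spectral_coef d A qa a) c.
Proof.
move=> a0 uE ha h0.
have stable := @krylov_stable _ _ M q.
have P0 : forall i, pact (ortho_poly u d) (u i) 0 = 0.
  apply: ortho_poly_annihilates u_real _ (char_poly_monic M) (size_char_poly M) _ => i.
  exact: pact_char_poly.
have := krylov_tracks a d; rewrite /spectral_coef.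
have : ortho_poly u d = head 0 (gram_schmidt u d) by [].
have : gram_schmidt u d != [::].
  by have := mem_gram_schmidt u (leqnn d); case: gram_schmidt.
case: (gram_schmidt u d) => //= P L _ PE LL'; inversion LL' as [|? x ? L2 Px _ E1 E2].
have [Q [xP PQ xQ xl]] := Px.
have Pu i n : pact P (u i) n = 0 by apply: stable => j; rewrite -PE; exact: P0.
have hu (G : {poly K}) i n :
    pact (h i) (pact G (u i)) n = c i * (((h i) * G).[val a] * val a ^+ n).
  rewrite -pactM (eq_pact _ (uE i)) pact_add pact_geometric.
  by rewrite [X in pact X (rest i)]mulrC pactM pact0 ?addr0.
have coefE : val (AMul (is_zero x.2.1) (AInv x.2.2)) =
    (val x.2.1 == 0)%:R * (val x.2.2)^-1 by rewrite -val_is_zero.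
apply: reps_eq (reps_vscale _ xQ) => i.
rewrite coefE; have [al0|al0] := eqVneq (val x.2.1) 0; last first.
  have := hu P i 0; rewrite pact0 // => /esym/eqP.
  rewrite expr0 mulr1 hornerM mulf_eq0 mulf_eq0 (negPf (ha i)) /= => /orP[/eqP->|].
    by rewrite mul0r mul0r.
  by rewrite PQ !hornerE subrr mul0r add0r (negPf al0).
rewrite al0 addr0 in PQ.
(* The product of all h j serves every coordinate at once: times X - lambda it kills each u i, and
   it does not vanish at lambda. *)
have Q0 : Q.[val a] != 0.
  apply: (ortho_poly_simple_root u_real stable P0 a0 (h := \prod_j h j) _ _ (etrans PE PQ)).
  - by rewrite horner_prod; apply/prodf_neq0 => j _.
  - move=> j n; rewrite (eq_pact _ (uE j)) pact_add pact_geometric hornerM hornerXsubC.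
    by rewrite subrr !mul0r mulr0 add0r (bigD1 j) //= mulrCA mulrC pactM pact0.
rewrite mul1r xl.
have QE n : pact Q (u i) n = pact Q (u i) 0 * val a ^+ n.
  elim: n => [|n IH]; first by rewrite mulr1.
  have := Pu i n; rewrite PQ pactM pact_subX => /eqP; rewrite subr_eq0 => /eqP ->.
  by rewrite IH exprS mulrCA.
(* h i Q is applied to u i in two ways: through the geometric sequence Q u i, and through the
   splitting of u i. *)
have := hu Q i 0; rewrite (eq_pact _ QE) pact_geometric expr0 !mulr1 hornerM.
move=> hQ; have -> : pact Q (u i) 0 = c i * Q.[val a].
  by apply: (mulIf (ha i)); rewrite hQ; ring.
by field.
Qed.

End SpectralCoefficients.

(** * Decay of the contracting part *)

Section Decay.
Variable R : realType.
Local Notation K := R[i].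

(** The norm of [R[i]] is complex-valued; this is the same number as an element of R, where limits
    are taken. *)
Definition cnorm (z : K) : R := complex.Re `|z|.

Lemma cnormE (z : K) : `|z| = (cnorm z)%:C%C.
Proof. by rewrite /cnorm normc_def. Qed.

Lemma cnorm_ge0 (z : K) : 0 <= cnorm z.
Proof. by rewrite -lecR -cnormE normr_ge0. Qed.

Lemma cnormM (y z : K) : cnorm (y * z) = cnorm y * cnorm z.
Proof. by apply: complexI; rewrite rmorphM /= -!cnormE normrM. Qed.

Lemma cnormD (y z : K) : cnorm (y + z) <= cnorm y + cnorm z.
Proof. by rewrite -lecR rmorphD /= -!cnormE ler_normD. Qed.

Lemma cnorm_real (x : R) : cnorm x%:C%C = `|x|.
Proof. by rewrite /cnorm normc_def /= expr0n addr0 sqrtr_sqr. Qed.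

Definition vanishing (x : nat -> R) :=
  forall e, 0 < e -> exists N, forall n, (N <= n)%N -> `|x n| < e.

Lemma contraction_vanishing (a b : nat -> R) (r : R) : 0 <= r < 1 ->
  (forall n, 0 <= a n) -> (forall n, a n.+1 <= r * a n + b n) ->
  vanishing b -> vanishing a.
Proof.
move=> /andP[r0 r1] a0 ab b0 e e0.
(* e / 2 is the fixed point of x |-> r x + e / 2 * (1 - r), so from N on only the geometric part r^k
   a_N can exceed it. *)
have [N NP] := b0 (e / 2 * (1 - r)) ltac:(rewrite mulr_gt0 // ?divr_gt0 // subr_gt0 //).
have aN k : a (N + k)%N <= r ^+ k * a N + e / 2.
  elim: k => [|k IH]; first by rewrite addn0 expr0 mul1r lerDl ltW // divr_gt0.
  rewrite addnS (le_trans (ab _)) // exprS.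
  have := NP (N + k)%N (leq_addr _ _); move/ltr_normlW => bk.
  have := ler_wpM2l r0 IH; lra.
have : r ^+ k @[k --> \oo] --> (0 : R) by apply: cvg_expr; rewrite ger0_norm.
move=> /cvgrPdist_lt /(_ (e / 2 / (a N + 1))) [].
  by rewrite !divr_gt0 // ltr_wpDl.
move=> N2 _ N2P; exists (N + N2)%N => n nN.
have [k kN ->] : exists2 k, (N2 <= k)%N & n = (N + k)%N.
  have Nn := leq_trans (leq_addr _ _) nN.
  by exists (n - N)%N; [rewrite leq_subRL|rewrite subnKC].
rewrite ger0_norm // (le_lt_trans (aN k)) //.
have := N2P k kN; rewrite /= sub0r normrN ger0_norm ?exprn_ge0 // => rk.
have aN0 := a0 N.
suff : r ^+ k * a N < e / 2 by lra.
rewrite (@le_lt_trans _ _ (r ^+ k * (a N + 1))) //.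
  by rewrite ler_wpM2l ?exprn_ge0 // lerDl.
by rewrite -ltr_pdivlMr // ltr_wpDl.
Qed.

(** Peel off one factor: with S the shift, |w_(n+1)| <= |z| |w_n| + |((S - z) w)_n|, and the last
    term vanishes by induction. Repeated roots need no separate treatment. *)
Lemma annihilated_vanishing (s : seq K) (w : nat -> K) :
  (forall z, z \in s -> `|z| < 1) ->
  (forall n, pact (\prod_(z <- s) ('X - z%:P)) w n = 0) ->
  vanishing (fun n => cnorm (w n)).
Proof.
elim: s w => [|z s IH] w s1 w0.
  move=> e e0; exists 0%N => n _; rewrite ger0_norm ?cnorm_ge0 //.
  have := w0 n; rewrite big_nil -[1]/(1%:P) pactC mul1r => ->.
  by rewrite -[0]/(0%:C)%C cnorm_real normr0.
apply: (@contraction_vanishing _ (fun n => cnorm (pact ('X - z%:P) w n)) (cnorm z)).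
- by rewrite cnorm_ge0 -ltcR -cnormE s1 // inE eqxx.
- by move=> n; apply: cnorm_ge0.
- by move=> n; rewrite pact_subX -cnormM addrC -[X in cnorm X <= _](subrK (z * w n)) cnormD.
apply: IH => [y ys|n]; first by apply: s1; rewrite inE ys orbT.
by rewrite -pactM mulrC -[RHS](w0 n) big_cons.
Qed.

End Decay.

(** * Closed form of the modulus-one part *)

Section SpectralSet.
Variable R : realType.
Local Notation K := R[i].
Local Notation val := (aterm_val R).

Lemma lrs_char_poly_annihilates (D : set K) (u : nat -> K) (chi : {poly K}) :
  lrs_char_poly D u chi -> chi \is monic /\ forall n, pact chi u n = 0.
Proof.
move=> [k [a [[[_ _ rec] _] ->]]]; split.
  rewrite monicE lead_coefDl ?lead_coefXn // size_polyN size_polyXn ltnS.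
  apply: leq_trans (size_sum _ _ _) _; apply/bigmax_leqP => i _.
  by rewrite (leq_trans (size_scale_leq _ _)) // size_polyXn ltn_ord.
move=> n; rewrite pactD pactN pactXn rec pact_polysum; apply/eqP; rewrite subr_eq0.
by apply/eqP; apply: eq_bigr => i _; rewrite pactZ pactXn.
Qed.

Lemma monic_prod_roots (chi : {poly K}) : chi \is monic ->
  exists2 s : seq K, chi = \prod_(z <- s) ('X - z%:P) & forall z, (z \in s) = root chi z.
Proof.
move=> cm; have [s sP] := closed_field_poly_normal chi; exists s.
  by rewrite {1}sP (eqP cm) scale1r.
by move=> z; rewrite sP (eqP cm) scale1r root_prod_XsubC.
Qed.

Lemma map_mx_ratr_exp (F : numFieldType) d (M : 'M[rat]_d) n :
  map_mx ratr (M ^+ n) = map_mx ratr M ^+ n :> 'M[F]_d.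
Proof.
elim: n => [|n IH]; first by rewrite !expr0 map_mx1.
by rewrite !exprS -IH -!mulmxE map_mxM.
Qed.

Lemma orbit_point_complex d (M : 'M[rat]_d) (q : 'cV[rat]_d) n i :
  (orbit_point R M q n i ord0)%:C%C =
  (map_mx ratr M ^+ n *m map_mx ratr q : 'cV[K]_d) i ord0.
Proof.
by rewrite -map_mx_ratr_exp -map_mxM !mxE; apply: (fmorph_rat (real_complex R)).
Qed.

(** The annihilator g of the decaying part is kept: all its roots lie inside the unit disc, so it
    kills w without vanishing at any lambda_j. *)
Lemma spectral_set_decomposition d (M : 'M[rat]_d) (q : 'cV[rat]_d) l
    (lambda : 'I_l -> K) : spectral_set M q lambda ->
  forall i : 'I_d, exists (v w : nat -> R) (s : seq K) (c : K -> K) (g : {poly K}),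
    [/\ forall n, orbit_point R M q n i ord0 = v n + w n,
        uniq s /\ (forall z, z \in s -> exists j, lambda j = z),
        forall n, (v n)%:C%C = \sum_(z <- s) c z * z ^+ n,
        (forall n, pact g (fun k => (w k)%:C%C) n = 0) /\ (forall z, root g z -> `|z| < 1)
      & vanishing w].
Proof.
move=> [_ H] i; have [v [w [uvw [chi [chiP sep _ chil]] [g [gP g1]]]]] := H i.
have [chim chiv] := lrs_char_poly_annihilates chiP.
have [gm gw] := lrs_char_poly_annihilates gP.
have [s chis rs] := monic_prod_roots chim.
have [s' gs rs'] := monic_prod_roots gm.
have us : uniq s.
  apply/negPn/negP => /negP; move: chis sep {rs chiv chiP chim chil}; move: chi => chi.
  elim: s chi => //= z s IH chi chis sep.
  rewrite big_cons in chis.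
  move/negP; rewrite negb_and negbK => /orP[zs|/negP us]; last first.
    apply: (IH _ erefl) => [y|//]; apply: contra (sep y) => /dvdp_trans; apply.
    by rewrite chis dvdp_mulIr.
  move: (sep z); rewrite chis expr2 dvdp_mul2l ?polyXsubC_eq0 // dvdp_XsubCl.
  by rewrite root_prod_XsubC zs.
have [c cP] : exists c : K -> K, forall n, (v n)%:C%C = \sum_(z <- s) c z * z ^+ n.
  by apply: distinct_roots_closed_form => // n; rewrite -chis.
exists v, w, s, c, g; split=> //.
  by split=> // z; rewrite rs; apply: chil.
have := @annihilated_vanishing _ s' (fun n => (w n)%:C%C).
rewrite -gs => V e e0; have [z|n|N NP] := V _ _ _ e0; first by rewrite rs'; apply: g1.
  exact: gw.
by exists N => n /NP; rewrite ger0_norm ?cnorm_ge0 // cnorm_real.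
Qed.

Lemma val_multiplicity (lams : seq aterm) (a : aterm) :
  val (multiplicity lams a) = \sum_(b <- lams) (val a == val b)%:R.
Proof.
rewrite /multiplicity val_asum big_map; apply: eq_bigr => b _.
by rewrite val_is_zero /= subr_eq0.
Qed.

Lemma spectral_coefs_closed_form d (M : 'M[rat]_d) (q : 'cV[rat]_d) l
    (lambda : 'I_l -> K) (code : 'I_l -> aterm) (A : seq (seq aterm)) (qa : seq aterm) :
  spectral_set M q lambda -> (forall j, val (code j) = lambda j) ->
  size A = d ->
  (forall i : 'I_d, reps (R := R) (nth [::] A i) (map_mx ratr M i : 'I_d -> K)) ->
  reps (R := R) qa (fun i : 'I_d => map_mx ratr q i ord0 : K) ->
  exists v : 'I_d -> nat -> R,
    (forall i, vanishing (fun n => orbit_point R M q n i ord0 - v i n)) /\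
    forall i n, (v i n)%:C%C = \sum_(j < l)
      val (nth (ARat 0) (nth [::] (spectral_coefs d A qa [seq code j | j <- enum 'I_l]) j) i)
        * lambda j ^+ n.
Proof.
move=> spec codeP sA AM qaq; have dec := spectral_set_decomposition spec.
have lam0 j : lambda j != 0.
  by have [/(_ j)[_ l1] _] := spec; rewrite -normr_eq0 l1 oner_eq0.
have lam1 j : `|lambda j| = 1 by have [/(_ j)[]] := spec.
(* The witnesses are packed into one tuple so that [choice] is applied once. *)
have [t tP] := choice (fun i => let: ex_intro v (ex_intro w (ex_intro s (ex_intro c
  (ex_intro g H)))) := dec i in
  ex_intro (fun t : (nat -> R) * (nat -> R) * seq K * (K -> K) * {poly K} =>
    [/\ forall n, orbit_point R M q n i ord0 = t.1.1.1.1 n + t.1.1.1.2 n,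
        uniq t.1.1.2 /\ (forall z, z \in t.1.1.2 -> exists j, lambda j = z),
        forall n, (t.1.1.1.1 n)%:C%C = \sum_(z <- t.1.1.2) t.1.2 z * z ^+ n,
        (forall n, pact t.2 (fun k => (t.1.1.1.2 k)%:C%C) n = 0) /\
        (forall z, root t.2 z -> `|z| < 1)
      & vanishing t.1.1.1.2]) (v, w, s, c, g) H).
pose v i := (t i).1.1.1.1; pose w i := (t i).1.1.1.2; pose s i := (t i).1.1.2.
pose c i := (t i).1.2; pose g i := (t i).2.
have {tP dec} tP i : [/\ forall n, orbit_point R M q n i ord0 = v i n + w i n,
        uniq (s i) /\ (forall z, z \in s i -> exists j, lambda j = z),
        forall n, (v i n)%:C%C = \sum_(z <- s i) c i z * z ^+ n,
        (forall n, pact (g i) (fun k => (w i k)%:C%C) n = 0) /\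
        (forall z, root (g i) z -> `|z| < 1)
      & vanishing (w i)] by exact: tP.
exists v; split=> [i|i n].
  have [uvw _ _ _ wP] := tP i.
  move=> e /wP[N NP]; exists N => n /NP; congr (_ < e); congr `|_|.
  by rewrite uvw addrC addKr.
(* A number lambda_j that is no root for coordinate i has coefficient 0 there. *)
pose C i z := if z \in s i then c i z else 0.
have coefP j : reps (R := R) (spectral_coef d A qa (code j)) (fun i => C i (lambda j)).
  (* The rest consists of the other frequencies and the decaying part; it is killed by the product
     of their annihilators, which is nonzero at lambda_j. *)
  pose s' i := [seq z <- s i | z != lambda j].
  apply: (reps_spectral_coef sA AM qaq _ (h := fun i => (\prod_(z <- s' i) ('X - z%:P)) * g i)
    (rest := fun i n => \sum_(z <- s' i) c i z * z ^+ n + (w i n)%:C%C)).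
  - by move=> k m; rewrite -orbit_point_complex; apply/complex_realP; eexists.
  - by rewrite codeP.
  - move=> k m; have [uvw [us _] vE _ _] := tP k.
    rewrite -orbit_point_complex uvw rmorphD /= vE addrA codeP; congr (_ + _).
    rewrite /C /s' big_filter; case: ifP => ls; first by rewrite (bigD1_seq (lambda j)).
    rewrite mul0r add0r big_seq [RHS]big_seq_cond; apply: eq_bigl => z.
    by case: (boolP (z \in s k)) => //= zs; apply/esym; apply: contraFneq ls => <-.
  - move=> k; have [_ _ _ [_ g1] _] := tP k.
    rewrite codeP hornerM mulf_neq0 //; last first.
      by apply/negP => /g1; rewrite lam1 ltxx.
    by rewrite -/(root _ _) root_prod_XsubC mem_filter eqxx.
  - move=> k m; have [_ _ _ [gw _] _] := tP k.
    rewrite pact_add [X in _ + X]pactM [X in _ + X]pact0 // addr0 mulrC pactM pact0 // => p.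
    rewrite pact_sum; apply: big1_seq => z /andP[_ zs].
    rewrite pact_geometric (_ : _.[z] = 0) ?mul0r ?mulr0 //.
    by apply/rootP; rewrite root_prod_XsubC.
have [_ [_ sl] vE _ _] := tP i; have [_ [us _] _ _ _] := tP i.
pose N z : K := \sum_(k < l) (z == lambda k)%:R.
have NE : forall j, val (AInv (multiplicity [seq code j | j <- enum 'I_l] (code j))) =
    (N (lambda j))^-1.
  move=> j; rewrite /= val_multiplicity big_map big_enum codeP; congr _^-1.
  by apply: eq_bigr => k _; rewrite codeP.
(* Both sides are brought to a double sum in which each root z is counted with weight 1 / N z for
   each of its N z indices. *)
transitivity (\sum_(j < l) \sum_(z <- s i)
    (N z)^-1 * (z == lambda j)%:R * (c i z * z ^+ n)); last first.
  apply: eq_bigr => j _.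
  have se : size [seq code j | j <- enum 'I_l] = l by rewrite size_map size_enum_ord.
  rewrite /spectral_coefs (nth_map (ARat 0)) ?se //.
  rewrite (nth_map j) ?size_enum_ord // nth_ord_enum.
  have [sc cE] := coefP j.
  have [_ ->] := reps_vscale (AInv (multiplicity [seq code j | j <- enum 'I_l] (code j)))
    (coefP j).
  rewrite NE /C; case: ifP => ls.
    rewrite (bigD1_seq (lambda j)) //= eqxx mulr1 big1 ?addr0 ?mulrA //.
    by move=> z /negPf ->; rewrite mulr0 mul0r.
  rewrite mulr0 mul0r big_seq big1 // => z zs.
  by case: eqVneq ls => [<-|_ _]; rewrite ?zs // mulr0 mul0r.
rewrite vE exchange_big; apply: eq_big_seq => z /sl[k zk] /=.
rewrite -mulr_suml -mulr_sumr mulVf ?mul1r // /N (bigD1 k) //= zk eqxx.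
by rewrite paddr_eq0 ?oner_eq0 // sumr_ge0 // => j _; case: eqP.
Qed.

End SpectralSet.

(** * The torus integral and trigonometric polynomials *)

Section TorusIntegral.
Variable R : realType.
Local Notation mu := (@lebesgue_measure R).
Local Notation I := (@torus_integral R _).

(* Uniform continuity and boundedness are inherited by partial integrals, which
   gives the integrability needed at each stage of the iterated integral. *)
Definition ucb (m : nat) (f : 'rV[R]_m -> R) :=
  (exists B, forall x, `|f x| <= B) /\
  forall e, 0 < e -> exists2 r, 0 < r & forall x y : 'rV[R]_m,
    (forall i, `|x ord0 i - y ord0 i| < r) -> `|f x - f y| < e.

Lemma ucb_lin m (f g : 'rV[R]_m -> R) (a b : R) :
  ucb f -> ucb g -> ucb (fun x => a * f x + b * g x).
Proof.
move=> [[B fB] fu] [[B' gB] gu]; split.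
  exists (`|a| * B + `|b| * B') => x.
  by rewrite (le_trans (ler_normD _ _)) // !normrM lerD // ler_wpM2l.
move=> e e0; pose c := `|a| + `|b| + 1.
have c0 : 0 < c by rewrite ltr_wpDl // addr_ge0.
have [r r0 rf] := fu (e / c) (divr_gt0 e0 c0).
have [s s0 sg] := gu (e / c) (divr_gt0 e0 c0).
exists (Num.min r s) => [|x y xy]; first by rewrite lt_min r0.
have {}rf : `|f x - f y| < e / c by apply: rf => i; have := xy i; rewrite lt_min => /andP[].
have {}sg : `|g x - g y| < e / c by apply: sg => i; have := xy i; rewrite lt_min => /andP[].
have -> : a * f x + b * g x - (a * f y + b * g y) = a * (f x - f y) + b * (g x - g y) by ring.
rewrite (le_lt_trans (ler_normD _ _)) // !normrM.
have -> : e = (`|a| + `|b| + 1) * (e / c) by rewrite mulrC divfK // gt_eqF.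
have := ler_wpM2l (normr_ge0 a) (ltW rf); have := ler_wpM2l (normr_ge0 b) (ltW sg).
have : 0 < e / c by rewrite divr_gt0.
lra.
Qed.

Lemma row_mx_close m (t t' r : R) (x y : 'rV[R]_m) : `|t - t'| < r ->
  (forall i, `|x ord0 i - y ord0 i| < r) ->
  forall i, `|(row_mx (t%:M : 'rV_1) x) ord0 i - (row_mx (t'%:M : 'rV_1) y) ord0 i| < r.
Proof.
move=> tt' xy i; rewrite !mxE; case: (fintype.split i) => j; last exact: xy.
by rewrite !ord1 !mxE !eqxx !mulr1n.
Qed.

Lemma ucb_slice m (f : 'rV[R]_m.+1 -> R) (t : R) :
  ucb f -> ucb (fun y : 'rV[R]_m => f (row_mx (t%:M : 'rV_1) y)).
Proof.
move=> [[B fB] fu]; split=> [|e e0]; first by exists B.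
have [r r0 rf] := fu e e0; exists r => // x y xy; apply: rf.
by apply: row_mx_close => //; rewrite subrr normr0.
Qed.

Lemma slice_close m (f : 'rV[R]_m.+1 -> R) : ucb f ->
  forall e, 0 < e -> exists2 r, 0 < r & forall t t', `|t - t'| < r ->
  forall y : 'rV[R]_m,
    `|f (row_mx (t%:M : 'rV_1) y) - f (row_mx (t'%:M : 'rV_1) y)| < e.
Proof.
move=> [_ fu] e e0; have [r r0 rf] := fu e e0; exists r => // t t' tt' y; apply: rf.
by apply: row_mx_close => // i; rewrite subrr normr0.
Qed.

Lemma unit_itvE : [set t : R | 0 <= t < 1] = [set` `[0, 1[%R].
Proof. by apply/seteqP; split=> t; rewrite /= in_itv. Qed.

Lemma unit_itv_measure : mu [set` `[0, 1[%R] = 1%E.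
Proof. by rewrite lebesgue_measure_itv /= lte01 sube0. Qed.

Lemma continuous_bounded_integrable (f : R -> R) (B : R) :
  (forall t, `|f t| <= B) ->
  (forall e, 0 < e -> exists2 r, 0 < r & forall t t', `|t - t'| < r -> `|f t - f t'| < e) ->
  mu.-integrable [set t : R | 0 <= t < 1] (EFin \o f).
Proof.
move=> fB fu; rewrite unit_itvE; apply: measurable_bounded_integrable => //.
- by rewrite /= unit_itv_measure ltry.
- apply: measurable_funTS; apply: continuous_measurable_fun => t.
  apply/cvgrPdist_lt => e e0; have [r r0 rP] := fu e e0.
  by exists r => // t' /= tt'; apply: rP.
- exists B; split; first exact: num_real.
  by move=> M BM t _; apply: le_trans (fB t) (ltW BM).
Qed.

(** The two claims are proved together: in the next dimension the slice integral must be integrable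
    in t, and its continuity in t comes from linearity and the bound applied to the difference of
    two slices. *)
Lemma torus_integral_linear_bounded m :
  (forall (f g : 'rV[R]_m -> R) a b, ucb f -> ucb g ->
    I (fun x => a * f x + b * g x) = a * I f + b * I g) /\
  (forall (f : 'rV[R]_m -> R) c, ucb f -> (forall x, `|f x| <= c) -> `|I f| <= c).
Proof.
elim: m => [|m [IHl IHb]]; first by split=> /= [f g a b _ _|f c _ fc].
have IHd (f g : 'rV[R]_m -> R) c : ucb f -> ucb g -> (forall x, `|f x - g x| <= c) ->
    `|I f - I g| <= c.
  move=> fu gu fg.
  have -> : I f - I g = I (fun x => 1 * f x + (-1) * g x).
    by rewrite IHl // mul1r mulN1r.
  by apply: IHb => [|x]; [exact: ucb_lin|rewrite mul1r mulN1r].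
have intg (f : 'rV[R]_m.+1 -> R) : ucb f -> mu.-integrable [set t : R | 0 <= t < 1]
    (EFin \o (fun t => I (fun y : 'rV[R]_m => f (row_mx (t%:M : 'rV_1) y)))).
  move=> fu; have [[B fB] _] := fu.
  apply: (@continuous_bounded_integrable _ B) => [t|e e0].
    by apply: IHb => [|y]; [exact: ucb_slice|exact: fB].
  have [r r0 rP] := slice_close fu (divr_gt0 e0 (ltr0n R 2)).
  exists r => // t t' /rP tt'; apply: (@le_lt_trans _ _ (e / 2)); last by lra.
  by apply: IHd => [||y]; [exact: ucb_slice|exact: ucb_slice|exact/ltW/tt'].
have mI : measurable [set t : R | 0 <= t < 1] by rewrite unit_itvE.
split=> [f g a b fu gu|f c fu fc] /=.
  rewrite -RintegralZl ?intg // -RintegralZl ?intg // -RintegralD //.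
  - by apply: eq_Rintegral => t _; rewrite IHl //; exact: ucb_slice.
  - exact: integrableZl (intg _ fu).
  - exact: integrableZl (intg _ gu).
rewrite (le_trans (le_normr_Rintegral _ (intg _ fu))) //.
apply: (@le_trans _ _ (\int[mu]_(t in [set t : R | 0 <= t < 1]) c)).
  apply: le_Rintegral => //.
  - exact: (integrable_norm (intg _ fu)).
  - apply: (@continuous_bounded_integrable _ `|c|) => // e e0.
    by exists 1 => // *; rewrite subrr normr0.
  - by move=> t _; apply: IHb => [|y]; [exact: ucb_slice|exact: fc].
by rewrite Rintegral_cst //= unit_itvE unit_itv_measure mulr1.
Qed.

Lemma torus_integral_dist m (f g : 'rV[R]_m -> R) c : ucb f -> ucb g ->
  (forall x, `|f x - g x| <= c) -> `|I f - I g| <= c.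
Proof.
have [IHl IHb] := torus_integral_linear_bounded m; move=> fu gu fg.
have -> : I f - I g = I (fun x => 1 * f x + (-1) * g x) by rewrite IHl // mul1r mulN1r.
by apply: IHb => [|x]; [exact: ucb_lin|rewrite mul1r mulN1r].
Qed.

Lemma torus_integral_cst m (c : R) : I (fun _ : 'rV[R]_m => c) = c.
Proof.
elim: m => [|m IH] //=; under eq_Rintegral => t _ do rewrite IH.
by rewrite unit_itvE Rintegral_cst //= unit_itv_measure mulr1.
Qed.

End TorusIntegral.

Section TrigonometricPolynomials.
Variable R : realType.
Local Notation I := (@torus_integral R _).

Definition lin m (k : 'I_m -> int) (x : 'rV[R]_m) : R :=
  \sum_j (k j)%:~R * x ord0 j.

Definition wave m (k : 'I_m -> int) (c : R) (x : 'rV[R]_m) : R :=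
  cos (2 * pi * lin k x + c).

(** The phase [c] covers sines, and a product of waves is again a sum of two waves, so real
    coefficients suffice. *)
Inductive trigpoly m : ('rV[R]_m -> R) -> Prop :=
| trigpoly_wave a k c : trigpoly (fun x => a * wave k c x)
| trigpoly_add f g : trigpoly f -> trigpoly g -> trigpoly (fun x => f x + g x)
| trigpoly_ext f g : f =1 g -> trigpoly f -> trigpoly g.

Lemma cos_period (x : R) (z : int) : cos (x + 2 * pi * z%:~R) = cos x.
Proof.
have P n y : cos (y + 2 * pi * n%:R) = cos y :> R.
  rewrite -[RHS](periodicn (@cosD2pi R) n); congr (cos (_ + _)).
  by rewrite -[RHS]mulr_natr -[pi *+ 2]mulr_natr; ring.
case: z => n; first by rewrite P.
by rewrite -[LHS](P n.+1); congr cos; rewrite NegzE mulrNz pmulrn; ring.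
Qed.

(** Modulo 1, y lies in [0, 1), and the sine is positive on ]0, pi[. Shifting by a multiple of pi
    may change the sign, whence the absolute values in the proof. *)
Lemma sin_pi_eq0 (y : R) : sin (pi * y) = 0 -> exists z : int, y = z%:~R.
Proof.
pose f := y - (Num.floor y)%:~R; have yE : y = f + (Num.floor y)%:~R by rewrite subrK.
have f0 : 0 <= f by rewrite subr_ge0 floor_le.
have f1 : f < 1 by rewrite ltrBlDl -intrD1 floorD1_gt.
have S (z : int) x : `|sin (x + pi * z%:~R)| = `|sin x| :> R.
  have P n t : `|sin (t + pi * n%:R)| = `|sin t| :> R.
    by rewrite mulr_natr (alternatingn (@sinDpi R)) normrM normrX normrN1 expr1n mul1r.
  case: z => n; first by rewrite P.
  by rewrite -[LHS](P n.+1); congr (`|sin _|); rewrite NegzE mulrNz pmulrn; ring.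
move=> sy; exists (Num.floor y); apply/eqP; rewrite -subr_eq0 -/f.
apply: contra_eqT sy => fn0; rewrite yE mulrDr -normr_eq0 S normr_eq0.
by rewrite gt_eqF // sin_gt0_pi // mulr_gt0 ?pi_gt0 ?lt0r ?fn0 //= gtr_pMr ?pi_gt0.
Qed.

Lemma cos_dist (a b : R) : `|cos a - cos b| <= 2 * `|sin ((a - b) / 2)|.
Proof.
have -> : cos a - cos b = - (2 * (sin ((a + b) / 2) * sin ((a - b) / 2))).
  have E p q : cos (p + q) - cos (p - q) = - (2 * (sin p * sin q)) :> R.
    by rewrite cosD cosB; ring.
  by rewrite -E; congr (cos _ - cos _); field.
rewrite normrN !normrM ger0_norm // ler_pM2l // ler_piMl //; exact: sin_max.
Qed.

(** The product formula for cos a - cos b leaves only the continuity of the sine at 0 to be used. *)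
Lemma cos_uniform e : 0 < e -> exists2 r : R, 0 < r &
  forall a b : R, `|a - b| < r -> `|cos a - cos b| < e.
Proof.
move=> e0; have /cvgrPdist_lt/(_ _ (divr_gt0 e0 (ltr0n R 2))) := @continuous_sin R 0.
rewrite sin0 => -[r /= r0 rP]; exists r => // a b ab.
rewrite (le_lt_trans (cos_dist a b)) // mulrC -ltr_pdivlMr //.
have := rP ((a - b) / 2); rewrite /= !sub0r !normrN; apply.
rewrite normrM [`|2^-1|]ger0_norm ?invr_ge0 // (le_lt_trans _ ab) //.
by rewrite ler_piMr // invf_le1 // ler1n.
Qed.

Lemma lin_dist m (k : 'I_m -> int) (x y : 'rV[R]_m) r :
  (forall i, `|x ord0 i - y ord0 i| < r) ->
  `|lin k x - lin k y| <= (\sum_j `|(k j)%:~R|) * r.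
Proof.
move=> xy; rewrite /lin -sumrB mulr_suml (le_trans (ler_norm_sum _ _ _)) // ler_sum // => j _.
by rewrite -mulrBr normrM ler_wpM2l // ltW.
Qed.

Lemma ucb_wave m (k : 'I_m -> int) c : ucb (wave k c).
Proof.
split; first by exists 1 => x; apply: cos_max.
(* The summand 1 keeps S positive for k = 0 and makes the final comparison strict. *)
move=> e /cos_uniform[r r0 rP]; pose S : R := (\sum_j `|(k j)%:~R|) + 1.
have S0 : 0 < S by apply: ltr_wpDl => //; apply: sumr_ge0 => j _.
have p0 : 0 < 2 * pi :> R by rewrite mulr_gt0 ?pi_gt0.
have q0 : 0 < r / (2 * pi * S) by apply: divr_gt0 => //; apply: mulr_gt0.
exists (r / (2 * pi * S)) => // x y xy.
apply: rP; rewrite (_ : _ - _ = 2 * pi * (lin k x - lin k y)); last by ring.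
rewrite normrM gtr0_norm // mulrC -ltr_pdivlMr //.
rewrite (le_lt_trans (lin_dist k xy)) //.
rewrite (@lt_le_trans _ _ (S * (r / (2 * pi * S)))) ?ltr_pM2r ?ltrDl //.
have E (p : R) : p != 0 -> S * (r / (2 * p * S)) = r / (2 * p).
  by move=> p'; field; rewrite p' gt_eqF.
by rewrite E // gt_eqF ?pi_gt0.
Qed.

Lemma ucb_trigpoly m (f : 'rV[R]_m -> R) : trigpoly f -> ucb f.
Proof.
elim=> [a k c|{}f g _ fu _ gu|{}f g fg _].
- have := ucb_lin a 0 (ucb_wave k c) (ucb_wave k c).
  by congr ucb; apply/funext => x; rewrite mul0r addr0.
- by have := ucb_lin 1 1 fu gu; congr ucb; apply/funext => x; rewrite !mul1r.
- by rewrite (_ : f = g) //; apply/funext.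
Qed.

Lemma trigpoly_scale m (f : 'rV[R]_m -> R) b : trigpoly f -> trigpoly (fun x => b * f x).
Proof.
elim=> [a k c|{}f g _ fT _ gT|{}f g fg _].
- by apply: trigpoly_ext (trigpoly_wave (b * a) k c) => x; rewrite mulrA.
- by apply: trigpoly_ext (trigpoly_add fT gT) => x; rewrite mulrDr.
- by apply: trigpoly_ext => x; rewrite fg.
Qed.

Lemma trigpoly_cst m b : trigpoly (fun _ : 'rV[R]_m => b).
Proof.
apply: trigpoly_ext (trigpoly_wave b (fun=> 0) 0) => x.
rewrite /wave /lin big1 ?mulr0 ?addr0 ?cos0 ?mulr1 // => j _; by rewrite mul0r.
Qed.

Lemma trigpoly_mul_wave m (f : 'rV[R]_m -> R) a k c : trigpoly f ->
  trigpoly (fun x => f x * (a * wave k c x)).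
Proof.
elim=> [a' k' c'|{}f g _ fT _ gT|{}f g fg _].
- apply: trigpoly_ext (trigpoly_add
    (trigpoly_wave (a' * a / 2) (fun j => k' j + k j) (c' + c))
    (trigpoly_wave (a' * a / 2) (fun j => k' j - k j) (c' - c))) => x.
  rewrite /wave; set u := 2 * pi * lin k' x + c'; set v := 2 * pi * lin k x + c.
  have -> : 2 * pi * lin (fun j => k' j + k j) x + (c' + c) = u + v.
    rewrite /u /v; suff -> : lin (fun j => k' j + k j) x = lin k' x + lin k x by ring.
    by rewrite /lin -big_split; apply: eq_bigr => j _; rewrite rmorphD /= mulrDl.
  have -> : 2 * pi * lin (fun j => k' j - k j) x + (c' - c) = u - v.
    rewrite /u /v; suff -> : lin (fun j => k' j - k j) x = lin k' x - lin k x by ring.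
    by rewrite /lin -sumrB; apply: eq_bigr => j _; rewrite rmorphB /= mulrBl.
  by rewrite cosD cosB; field.
- by apply: trigpoly_ext (trigpoly_add fT gT) => x; rewrite mulrDl.
- by apply: trigpoly_ext => x; rewrite fg.
Qed.

Lemma trigpoly_mul m (f g : 'rV[R]_m -> R) : trigpoly f -> trigpoly g ->
  trigpoly (fun x => f x * g x).
Proof.
move=> fT; elim=> [a k c|{}g h _ gT _ hT|{}g h gh _].
- exact: trigpoly_mul_wave.
- by apply: trigpoly_ext (trigpoly_add gT hT) => x; rewrite mulrDr.
- by apply: trigpoly_ext => x; rewrite gh.
Qed.

End TrigonometricPolynomials.

Section WaveIntegral.
Variable R : realType.
Local Notation mu := (@lebesgue_measure R).
Local Notation I := (@torus_integral R _).

Lemma integral_cos (z : int) (c : R) :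
  \int[mu]_(t in [set t : R | 0 <= t < 1]) cos (2 * pi * (z%:~R * t) + c) =
  if z == 0 then cos c else 0.
Proof.
have [->|z0] := eqVneq z 0.
  rewrite (@eq_Rintegral _ _ _ _ _ (fun=> cos c)); last first.
    by move=> t _; rewrite mul0r mulr0 add0r.
  by rewrite unit_itvE Rintegral_cst //= unit_itv_measure mulr1.
pose w : R := 2 * pi * z%:~R.
have w0 : w != 0 by rewrite !mulf_neq0 ?pnatr_eq0 ?intr_eq0 // gt_eqF ?pi_gt0.
pose f t := cos (w * t + c).
pose F t := w^-1 * sin (w * t + c).
have dF (t : R) : is_derive t (1 : R) F (f t).
  have dl : is_derive t (1 : R) (fun t : R => w * t + c) w.
    rewrite (_ : (fun t => _) = (w \*: (@id R)) + cst c) //.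
    by apply: is_derive_eq; rewrite addr0 /GRing.scale /= mulr1.
  have dc := @is_derive1_comp _ _ (fun t : R => w * t + c) t _ _ (is_derive_sin (w * t + c)) dl.
  rewrite (_ : F = w^-1 \*: (sin \o (fun t => w * t + c))) //.
  by apply: is_derive_eq; rewrite /GRing.scale /= mulrC mulfK.
have cf : continuous f.
  move=> t; apply: (@continuous_comp _ _ _ (fun t => w * t + c) cos); last exact: continuous_cos.
  apply: cvgD; last exact: cvg_cst.
  by apply: cvgMr; exact: cvg_id.
have cF : continuous F.
  by move=> t; apply: differentiable_continuous; apply/derivable1_diffP; have [] := dF t.
have : mu.-integrable [set t : R | 0 <= t < 1] (EFin \o f).
  apply: (@continuous_bounded_integrable _ _ 1) => [t|e /cos_uniform[r r0 rP]]; first exact: cos_max.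
  exists (r / `|w|) => [|t t' tt']; first by rewrite divr_gt0 ?normr_gt0.
  apply: rP; rewrite (_ : _ - _ = w * (t - t')); last by ring.
  by rewrite normrM mulrC -ltr_pdivlMr ?normr_gt0.
have -> : \int[mu]_(t in [set t : R | 0 <= t < 1]) cos (2 * pi * (z%:~R * t) + c) =
    \int[mu]_(t in [set t : R | 0 <= t < 1]) f t.
  by apply: eq_Rintegral => t _; rewrite /f /w !mulrA.
rewrite unit_itvE => intf; rewrite (Rintegral_itv_bndo_bndc intf) /Rintegral.
rewrite (continuous_FTC2 (F := F)) //=.
(* Sines are turned into shifted cosines so that [cos_period] shows that the primitive takes equal
   values at 0 and 1. *)
- rewrite /F mulr1 mulr0 add0r -[sin c]cosBpihalf -[sin (w + c)]cosBpihalf.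
  rewrite (_ : w + c - pi / 2 = c - pi / 2 + 2 * pi * z%:~R); last by rewrite /w; ring.
  by rewrite cos_period subrr.
- by apply: continuous_subspaceT.
- split.
  + by move=> t _; have [] := dF t.
  + exact/cvg_at_right_filter/cF.
  + exact/cvg_at_left_filter/cF.
- by move=> t _; rewrite derive1E; have [_ ->] := dF t.
Qed.

Lemma lin_row_mx m (k : 'I_m.+1 -> int) (t : R) (y : 'rV[R]_m) :
  lin k (row_mx (t%:M : 'rV_1) y) =
  (k ord0)%:~R * t + lin (fun j => k (lift ord0 j)) y.
Proof.
rewrite /lin big_ord_recl; congr (_ * _ + _).
  rewrite mxE; case: fintype.splitP => j //= j0.
  by rewrite !ord1 mxE ?eqxx ?mulr1n.
apply: eq_bigr => i _; congr (_ * _); rewrite mxE.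
case: fintype.splitP => j; first by rewrite ord1.
by rewrite /= /bump add1n => -[ij]; congr (y _ _); apply: ord_inj.
Qed.

Lemma torus_integral_wave m (k : 'I_m -> int) c :
  I (wave k c) = if [forall j, k j == 0] then cos c else 0.
Proof.
elim: m k c => [|m IH] k c.
  rewrite /= /wave /lin big_ord0 mulr0 add0r.
  by case: ifP => // /forallP; case=> -[].
have slice (t : R) : I (fun y : 'rV[R]_m => wave k c (row_mx (t%:M : 'rV_1) y)) =
    if [forall j, k (lift ord0 j) == 0]
    then cos (2 * pi * ((k ord0)%:~R * t) + c) else 0.
  rewrite -IH; congr (torus_integral _); apply/funext => y.
  by rewrite /wave lin_row_mx; congr cos; ring.
rewrite /=; under eq_Rintegral => t _ do rewrite slice.
have -> : [forall j, k j == 0] = (k ord0 == 0) && [forall j, k (lift ord0 j) == 0].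
  apply/forallP/andP => [k0|[k0 /forallP kS] j]; first by split=> //; apply/forallP.
  by have [j' ->|->] := unliftP ord0 j.
case: [forall j, k (lift ord0 j) == 0]; last by rewrite andbF unit_itvE Rintegral_cst // mul0r.
by rewrite andbT integral_cos.
Qed.

End WaveIntegral.

(** * Weyl's equidistribution theorem *)

Section Averages.
Variable R : realType.
Local Notation I := (@torus_integral R _).

Definition average (a : nat -> R) (n : nat) : R := n%:R^-1 * \sum_(0 <= i < n) a i.

Lemma eq_vanishing (a b : nat -> R) : a =1 b -> vanishing a -> vanishing b.
Proof. by move=> ab a0 e /a0[N NP]; exists N => n /NP; rewrite ab. Qed.

Lemma vanishing_add (a b : nat -> R) :
  vanishing a -> vanishing b -> vanishing (fun n => a n + b n).
Proof.
move=> a0 b0 e e0; have [N NP] := a0 _ (divr_gt0 e0 (ltr0n R 2)).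
have [N' NP'] := b0 _ (divr_gt0 e0 (ltr0n R 2)); exists (maxn N N') => n.
rewrite geq_max => /andP[/NP an /NP' bn].
by rewrite (le_lt_trans (ler_normD _ _)) // [e]splitr ltrD.
Qed.

Lemma vanishing_scale (a : nat -> R) c : vanishing a -> vanishing (fun n => c * a n).
Proof.
move=> a0 e e0; have c0 : 0 < `|c| + 1 by rewrite ltr_wpDl.
have [N NP] := a0 _ (divr_gt0 e0 c0); exists N => n /NP.
rewrite ltr_pdivlMr // normrM mulrC; apply: le_lt_trans.
by rewrite ler_wpM2r // lerDl.
Qed.

Lemma vanishing_bounded_div (b : R) (a : nat -> R) :
  (forall n, `|a n| <= b) -> vanishing (fun n => n%:R^-1 * a n).
Proof.
move=> ab e e0; exists (Num.truncn (b / e)).+1 => n nN.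
have n0 : 0 < n%:R :> R by rewrite ltr0n (leq_trans _ nN).
rewrite normrM normfV (gtr0_norm n0) mulrC ltr_pdivrMr //; apply: le_lt_trans (ab n) _.
by rewrite mulrC -ltr_pdivrMr // (lt_le_trans (truncnS_gt _)) // ler_nat.
Qed.

Lemma average_uniform_close (a b : nat -> R) e : 0 <= e ->
  (forall n, `|a n - b n| <= e) -> forall n, `|average a n - average b n| <= e.
Proof.
move=> e0 ab n; rewrite /average -mulrBr -sumrB.
case: n => [|n]; first by rewrite invr0 mul0r normr0.
rewrite normrM normfV normr_nat mulrC ler_pdivrMr ?ltr0n //.
rewrite (le_trans (ler_norm_sum _ _ _)) // (le_trans (ler_sum _ (fun i _ => ab i))) //.
by rewrite sumr_const_nat subn0 mulr_natr.
Qed.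

(** Multiplication by 2 sin(al / 2) makes the sum telescope, so the bound is independent of n. *)
Lemma sum_cos_bound (al c : R) n : sin (al / 2) != 0 ->
  `|\sum_(0 <= i < n) cos (i%:R * al + c)| <= `|sin (al / 2)|^-1.
Proof.
move=> s0; pose b i : R := sin (i%:R * al + c - al / 2).
have tel i : 2 * sin (al / 2) * cos (i%:R * al + c) = b i.+1 - b i.
  rewrite /b (_ : i.+1%:R * al + c - al / 2 = i%:R * al + c + al / 2); last first.
    by rewrite -natr1; field.
  by rewrite sinD sinB; ring.
have E : 2 * sin (al / 2) * \sum_(0 <= i < n) cos (i%:R * al + c) = b n - b 0.
  rewrite mulr_sumr; under eq_bigr => i _ do rewrite tel.
  by rewrite telescope_sumr.
have : `|b n - b 0| <= 2.
  by rewrite (le_trans (ler_normB _ _)) // -[2]/(1 + 1) lerD // sin_max.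
rewrite -E !normrM ger0_norm // -mulrA -[X in _ <= X]mulr1 ler_pM2l // => H.
by rewrite -[X in _ <= X]mul1r ler_pdivlMr ?normr_gt0 // mulrC.
Qed.

Variables (m : nat) (theta : 'rV[R]_m).
Hypothesis theta_indep : forall (c0 : rat) (c : 'I_m -> rat),
  ratr c0 + \sum_(j < m) ratr (c j) * theta ord0 j = 0 -> c0 = 0 /\ forall j, c j = 0.

Definition torus_orbit (n : nat) : 'rV[R]_m := \row_j frac_part (n%:R * theta ord0 j).

(** Since k is integral, taking fractional parts changes the angle only by a multiple of 2 pi. *)
Lemma wave_orbit (k : 'I_m -> int) c n :
  wave k c (torus_orbit n) = cos (n%:R * (2 * pi * lin k theta) + c).
Proof.
pose z : int := \sum_j k j * Num.floor (n%:R * theta ord0 j).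
rewrite -[RHS](cos_period _ (- z)); congr cos.
suff -> : lin k (torus_orbit n) = n%:R * lin k theta - z%:~R by rewrite rmorphN /=; ring.
rewrite /lin /z rmorph_sum mulr_sumr -sumrB; apply: eq_bigr => j _.
by rewrite mxE /frac_part rmorphM /=; ring.
Qed.

Definition equidistributed (f : 'rV[R]_m -> R) :=
  vanishing (fun n => average (fun i => f (torus_orbit i)) n - I f).

Lemma wave_equidistributed (k : 'I_m -> int) c : equidistributed (wave k c).
Proof.
rewrite /equidistributed torus_integral_wave; case: ifPn => [/forallP k0|kn0].
  move=> e e0; exists 1%N => n n0; rewrite (_ : average _ n = cos c) ?subrr ?normr0 //.
  rewrite /average (eq_bigr (fun=> cos c)) ?sumr_const_nat; last first.
    move=> i _; rewrite /wave /lin big1 ?mulr0 ?add0r // => j _.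
    by rewrite (eqP (k0 j)) mul0r.
  by rewrite subn0 -[cos c *+ n]mulr_natl mulKf // pnatr_eq0 -lt0n.
(* A zero sine would make k . theta an integer, a rational relation between 1 and the theta_j, which
   forces k = 0. *)
have s0 : sin (2 * pi * lin k theta / 2) != 0.
  apply: contraNneq kn0 => s0.
  have [z zE] : exists z : int, lin k theta = z%:~R.
    by apply: sin_pi_eq0; rewrite -s0; congr sin; field.
  have [|_ k0] := theta_indep (c0 := (- z)%:~R) (c := fun j => (k j)%:~R).
    rewrite ratr_int rmorphN /= -zE addrC; apply/eqP; rewrite subr_eq0; apply/eqP.
    by apply: eq_bigr => j _; rewrite ratr_int.
  by apply/forallP => j; have /eqP := k0 j; rewrite intr_eq0.
have := vanishing_bounded_div (fun n => @sum_cos_bound _ c n s0).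
apply: eq_vanishing => n; rewrite subr0 /average; congr (_ * _).
by apply: eq_bigr => i _; rewrite wave_orbit.
Qed.

Lemma trigpoly_equidistributed f : trigpoly f -> equidistributed f.
Proof.
elim=> [a k c|{}f g fT fE gT gE|{}f g fg _].
- have [L _] := torus_integral_linear_bounded R m.
  rewrite /equidistributed (_ : I _ = a * I (wave k c)); last first.
    have := L _ _ a 0 (ucb_wave k c) (ucb_wave k c); rewrite mul0r addr0 => <-.
    by congr (torus_integral _); apply/funext => x; rewrite mul0r addr0.
  apply: eq_vanishing (vanishing_scale a (wave_equidistributed k c)) => n.
  rewrite mulrBr /average -mulr_sumr; congr (_ - _); ring.
- have [L _] := torus_integral_linear_bounded R m.
  rewrite /equidistributed (_ : I _ = I f + I g); last first.
    have := L _ _ 1 1 (ucb_trigpoly fT) (ucb_trigpoly gT); rewrite !mul1r => <-.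
    by congr (torus_integral _); apply/funext => x; rewrite !mul1r.
  apply: eq_vanishing (vanishing_add fE gE) => n.
  rewrite /average big_split /=; ring.
- by rewrite (_ : f = g) //; apply/funext.
Qed.

End Averages.

(** * Uniform limits of trigonometric polynomials *)

Section Approximation.
Variables (R : realType) (m : nat).
Local Notation I := (@torus_integral R _).
Implicit Types f g : 'rV[R]_m -> R.

Definition approximable f :=
  forall e, 0 < e -> exists2 g, trigpoly g & forall x, `|f x - g x| <= e.

Lemma approximable_trigpoly f : trigpoly f -> approximable f.
Proof. by move=> fT e e0; exists f => // x; rewrite subrr normr0 ltW. Qed.

Lemma approximable_lim f :
  (forall e, 0 < e -> exists2 g, approximable g & forall x, `|f x - g x| <= e) ->
  approximable f.
Proof.
move=> fl e e0; have e2 : 0 < e / 2 by rewrite divr_gt0.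
have [g gA fg] := fl _ e2; have [h hT gh] := gA _ e2; exists h => // x.
have -> : f x - h x = (f x - g x) + (g x - h x) by ring.
by rewrite (le_trans (ler_normD _ _)) // [e]splitr lerD.
Qed.

Lemma approximable_bounded f : approximable f -> exists2 B, 0 < B & forall x, `|f x| <= B.
Proof.
move=> /(_ _ ltr01)[g /ucb_trigpoly[[B gB] _] fg]; exists (`|B| + 1) => [|x].
  by rewrite ltr_wpDl.
have -> : f x = g x + (f x - g x) by ring.
by rewrite (le_trans (ler_normD _ _)) // lerD // (le_trans (gB x)) // ler_norm.
Qed.

Lemma ucb_approximable f : approximable f -> ucb f.
Proof.
move=> fA; split; first by have [B _ fB] := approximable_bounded fA; exists B.
move=> e e0; have e3 : 0 < e / 3 by rewrite divr_gt0.
have [g /ucb_trigpoly[_ /(_ _ e3)[r r0 rP]] fg] := fA _ e3; exists r => // x y /rP gxy.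
have -> : f x - f y = (f x - g x) + (g x - g y) - (f y - g y) by ring.
rewrite (le_lt_trans (ler_normB _ _)) // (le_lt_trans (lerD (ler_normD _ _) (lexx _))) //.
have := fg x; have := fg y; lra.
Qed.

Lemma approximable_add f g : approximable f -> approximable g ->
  approximable (fun x => f x + g x).
Proof.
move=> fA gA e e0; have e2 : 0 < e / 2 by rewrite divr_gt0.
have [f' fT ff] := fA _ e2; have [g' gT gg] := gA _ e2.
exists (fun x => f' x + g' x) => [|x]; first exact: trigpoly_add.
have -> : f x + g x - (f' x + g' x) = (f x - f' x) + (g x - g' x) by ring.
by rewrite (le_trans (ler_normD _ _)) // [e]splitr lerD.
Qed.

Lemma approximable_cst c : approximable (fun=> c).
Proof. exact/approximable_trigpoly/trigpoly_cst. Qed.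

Lemma approximable_mul f g : approximable f -> approximable g ->
  approximable (fun x => f x * g x).
Proof.
move=> fA gA e e0; have [B B0 fB] := approximable_bounded fA.
have [B' B'0 gB] := approximable_bounded gA.
have [f' fT ff] := fA (e / 2 / B') ltac:(by rewrite !divr_gt0).
have [[Bf f'B] _] := ucb_trigpoly fT.
have Bf0 : 0 < `|Bf| + 1 by rewrite ltr_wpDl.
(* g' is chosen after f', because its tolerance depends on a bound of f' and not of f. *)
have [g' gT gg] := gA (e / 2 / (`|Bf| + 1)) ltac:(by rewrite !divr_gt0).
exists (fun x => f' x * g' x) => [|x]; first exact: trigpoly_mul.
have -> : f x * g x - f' x * g' x = (f x - f' x) * g x + f' x * (g x - g' x) by ring.
rewrite (le_trans (ler_normD _ _)) // !normrM [e]splitr lerD //.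
  have -> : e / 2 = (e / 2 / B') * B' by rewrite divfK // gt_eqF.
  by rewrite ler_pM.
have -> : e / 2 = (`|Bf| + 1) * (e / 2 / (`|Bf| + 1)) by rewrite [RHS]mulrC divfK // gt_eqF.
by rewrite ler_pM // (le_trans (f'B x)) // (le_trans (ler_norm _)) // lerDl.
Qed.

Lemma approximable_sum (J : Type) (r : seq J) (F : J -> 'rV[R]_m -> R) :
  (forall j, approximable (F j)) -> approximable (fun x => \sum_(j <- r) F j x).
Proof.
move=> FA; elim: r => [|j r IH].
  rewrite (_ : (fun _ => _) = fun=> 0); first exact: approximable_cst.
  by apply/funext => x; rewrite big_nil.
rewrite (_ : (fun _ => _) = fun x => F j x + \sum_(j <- r) F j x).
  exact: approximable_add.
by apply/funext => x; rewrite big_cons.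
Qed.

Lemma approximable_prod (J : Type) (r : seq J) (F : J -> 'rV[R]_m -> R) :
  (forall j, approximable (F j)) -> approximable (fun x => \prod_(j <- r) F j x).
Proof.
move=> FA; elim: r => [|j r IH].
  rewrite (_ : (fun _ => _) = fun=> 1); first exact: approximable_cst.
  by apply/funext => x; rewrite big_nil.
rewrite (_ : (fun _ => _) = fun x => F j x * \prod_(j <- r) F j x).
  exact: approximable_mul.
by apply/funext => x; rewrite big_cons.
Qed.

(* Converges to |y| for |y| <= 1 while being polynomial in y at each step. *)
Fixpoint abs_iter (y : R) (n : nat) : R :=
  if n is n'.+1 then let p := abs_iter y n' in p + (y ^+ 2 - p ^+ 2) / 2 else 0.

(** With s = |y|, each step multiplies the error s - p by 1 - (s + p) / 2 <= 1 - s / 2. The third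
    clause states this decay as an invariant; it yields an error of at most 2 / n uniformly in y,
    even near y = 0. *)
Lemma abs_iter_bounds y n : `|y| <= 1 ->
  [/\ 0 <= abs_iter y n, abs_iter y n <= `|y| &
      (`|y| - abs_iter y n) * (n%:R * `|y| / 2 + 1) <= `|y|].
Proof.
set s := `|y| => s1.
have s0 : 0 <= s by exact: normr_ge0.
have y2 : y ^+ 2 = s ^+ 2 by rewrite /s real_normK ?num_real.
elim: n => [|n [p0 ps IH]] /=; first by split=> //; lra.
rewrite y2; set p := abs_iter y n in p0 ps IH *.
have sp : s - (p + (s ^+ 2 - p ^+ 2) / 2) = (s - p) * (1 - (s + p) / 2) by field.
split; [nra| |].
  by rewrite -subr_ge0 sp mulr_ge0 //; lra.
rewrite sp -[n.+1%:R]natr1; apply: le_trans IH; rewrite -mulrA ler_wpM2l ?subr_ge0 //.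
have n0 : 0 <= n%:R :> R by [].
have ns : 0 <= n%:R * s by rewrite mulr_ge0.
have nss : 0 <= n%:R * s * s by rewrite mulr_ge0.
have nsp : 0 <= n%:R * s * p by rewrite mulr_ge0.
have ss : 0 <= s * s by rewrite mulr_ge0.
have sp0 : 0 <= s * p by rewrite mulr_ge0.
nra.
Qed.

Lemma abs_iter_close y n : `|y| <= 1 -> `| `|y| - abs_iter y n.+1| <= 2 / n.+1%:R.
Proof.
move=> y1; have [p0 py H] := abs_iter_bounds n.+1 y1.
rewrite ger0_norm ?subr_ge0 //; have [y0|y0] := eqVneq `|y| 0.
  by rewrite (le_trans (y := 0)) ?divr_ge0 // y0 sub0r oppr_le0.
have {}y0 : 0 < `|y| by rewrite lt_neqAle eq_sym y0 normr_ge0.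
rewrite ler_pdivlMr // -(ler_pM2r y0).
have : 0 <= `|y| - abs_iter y n.+1 by rewrite subr_ge0.
move: H; set D := `|y| - _; set k : R := n.+1%:R => H D0.
have : D * (k * `|y| / 2) <= `|y| by move: H; rewrite mulrDr mulr1; lra.
lra.
Qed.

Lemma approximable_abs f : approximable f -> approximable (fun x => `|f x|).
Proof.
move=> fA; have [B B0 fB] := approximable_bounded fA.
pose y x := B^-1 * f x.
have yA : approximable y by apply: approximable_mul => //; exact: approximable_cst.
have y1 x : `|y x| <= 1.
  by rewrite /y normrM gtr0_norm ?invr_gt0 // ler_pdivrMl // mulr1.
have itA n : approximable (fun x => abs_iter (y x) n).
  elim: n => [|n IH] /=; first exact: approximable_cst.
  rewrite (_ : (fun x => _) = fun x => abs_iter (y x) n +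
    2^-1 * (y x * y x + (-1) * (abs_iter (y x) n * abs_iter (y x) n))); last first.
    by apply/funext => x; rewrite !expr2; field.
  apply: approximable_add => //; apply: approximable_mul; first exact: approximable_cst.
  apply: approximable_add; first exact: approximable_mul.
  apply: approximable_mul; [exact: approximable_cst|exact: approximable_mul].
rewrite (_ : (fun x => _) = fun x => B * `|y x|); last first.
  by apply/funext => x; rewrite /y normrM gtr0_norm ?invr_gt0 // mulrA divff ?mul1r // gt_eqF.
apply: approximable_mul; first exact: approximable_cst.
apply: approximable_lim => e e0; pose n := Num.truncn (2 / e).
exists (fun x => abs_iter (y x) n.+1) => // x.
apply: le_trans (abs_iter_close n (y1 x)) _.
by rewrite ler_pdivrMr // mulrC -ler_pdivrMr // ltW // truncnS_gt.
Qed.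

(** Averages along the orbit and the torus integral both move by at most the uniform distance, so
    equidistribution passes to uniform limits. *)
Lemma approximable_equidistributed (theta : 'rV[R]_m) f :
  (forall (c0 : rat) (c : 'I_m -> rat),
    ratr c0 + \sum_(j < m) ratr (c j) * theta ord0 j = 0 -> c0 = 0 /\ forall j, c j = 0) ->
  approximable f -> equidistributed theta f.
Proof.
move=> ind fA e e0; have e3 : 0 < e / 4 by rewrite divr_gt0.
have [g gT fg] := fA _ e3.
have [N NP] := trigpoly_equidistributed ind gT e3; exists N => n /NP gn.
have fu := ucb_approximable fA; have gu := ucb_trigpoly gT.
have If : `|I f - I g| <= e / 4 by exact: torus_integral_dist.
have := average_uniform_close (ltW e3) (fun i => fg (torus_orbit theta i)) n.
set a := average _ n; set b := average _ n => ab.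
rewrite (_ : a - I f = (a - b) + (b - I g) - (I f - I g)); last by ring.
rewrite (le_lt_trans (ler_normB _ _)) // (le_lt_trans (lerD (ler_normD _ _) (lexx _))) //.
lra.
Qed.

End Approximation.

(** * Composition with a continuous function *)

Section TentFunctions.
Variable R : realType.

(** The hat function max(0, 1 - |t|), written with absolute values because these preserve uniform
    limits of trigonometric polynomials. *)
Definition tent (t : R) : R := (1 - `|t| + `|1 - `|t| |) / 2.

Lemma tent_ge0 t : 0 <= tent t.
Proof. by rewrite /tent; have := ler_norm (- (1 - `|t|)); rewrite normrN; lra. Qed.

Lemma tent_out t : 1 <= `|t| -> tent t = 0.
Proof. by move=> t1; rewrite /tent [`|1 - _|]ler0_norm ?subr_le0 //; lra. Qed.

Lemma tent_in t : `|t| <= 1 -> tent t = 1 - `|t|.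
Proof. by move=> t1; rewrite /tent [`|1 - _|]ger0_norm ?subr_ge0 //; lra. Qed.

Lemma tent_partition (K : nat) (z : R) : 0 <= z <= K%:R ->
  \sum_(j < K.+1) tent (z - j%:R) = 1.
Proof.
elim: K => [|K IH] /andP[z0 zK].
  have -> : z = 0 by apply/eqP; rewrite eq_le zK z0.
  by rewrite big_ord1 subr0 tent_in ?normr0 // subr0.
rewrite big_ord_recr /=; have [zK'|zK'] := lerP z K%:R.
  rewrite IH ?z0 // tent_out ?addr0 // -natr1 ler0_norm; lra.
(* For K < z only the hats centred at K and K + 1 reach z. *)
rewrite big_ord_recr big1 /= => [|j _]; last first.
  have jK : j%:R + 1 <= K%:R :> R by rewrite natr1 ler_nat ltn_ord.
  by rewrite tent_out // ger0_norm; lra.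
move: zK; rewrite -natr1 => zK.
rewrite add0r tent_in ?ger0_norm ?tent_in ?ler0_norm; lra.
Qed.

End TentFunctions.

Section UniformContinuity.
Variables (R : realType) (d : nat) (w : 'cV[R]_d -> R).
Hypothesis w_cont : continuous w.

Lemma continuous_coord (x : 'cV[R]_d) e : 0 < e -> exists2 r, 0 < r &
  forall y : 'cV[R]_d, (forall i, `|x i ord0 - y i ord0| < r) -> `|w x - w y| < e.
Proof.
move=> e0; have /cvgrPdist_lt/(_ _ e0) := @w_cont x.
rewrite -nbhs_ballE => -[r /= r0 rP]; exists r => // y xy; apply: rP.
split=> [|i j]; first by []. rewrite !ord1; exact: xy.
Qed.

(** Heine-Cantor, with only x confined to the box. The compact box consists of row vectors, hence
    the transposes. *)
Lemma uniformly_continuous_box (B e : R) : 0 < e -> exists2 r, 0 < r &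
  forall x y : 'cV[R]_d, (forall i, `|x i ord0| <= B) ->
    (forall i, `|x i ord0 - y i ord0| < r) -> `|w x - w y| < e.
Proof.
move=> e0; pose A := [set v : 'rV[R]_d | forall i, `[- B, B]%classic (v ord0 i)].
have cA : compact A.
  apply: (@rV_compact R d (fun=> `[- B, B]%classic)) => i.
  exact: segment_compact.
pose P (r : R) (x : 'rV[R]_d) := forall y : 'cV[R]_d,
  (forall i, `|x ord0 i - y i ord0| < r) -> `|w x^T - w y| < e.
have /compact_near_coveringP /(_ R 0^'+ P _) H := cA.
have [x Ax|r /= r0 rP] := H.
  have [r r0 rP] := continuous_coord x^T (divr_gt0 e0 (ltr0n R 2)).
  have r2 : 0 < r / 2 by rewrite divr_gt0.
  exists (ball x (r / 2), [set t | 0 < t < r / 2]) => /=.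
    split; first exact: nbhsx_ballx.
    exists (r / 2) => //= t; rewrite /ball_ /= sub0r normrN => tr t0.
    by rewrite t0 /= (le_lt_trans (ler_norm t)).
  move=> [x' t] /= [xx' /andP[t0 tr]] y xy.
  have c' i : `|x ord0 i - x' ord0 i| < r / 2 by have [_ /(_ ord0 i)] := xx'.
  have wx' : `|w x^T - w x'^T| < e / 2.
    by apply: rP => i; rewrite !mxE; have := c' i; lra.
  have wy : `|w x^T - w y| < e / 2.
    apply: rP => i; rewrite !mxE; have := c' i; have := xy i.
    have := ler_distD (x' ord0 i) (x ord0 i) (y i ord0); lra.
  have := ler_distD (w x^T) (w x'^T) (w y); rewrite [`|w x'^T - w x^T|]distrC; lra.
exists (r / 2) => [|x y xB xy]; first by rewrite divr_gt0.
have := rP (r / 2); rewrite /ball_ /= sub0r normrN gtr0_norm ?divr_gt0 //.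
move=> /(_ ltac:(lra) ltac:(lra) x^T); rewrite /P trmxK; apply.
  by move=> i; rewrite mxE /= in_itv /= -ler_norml.
by move=> i; rewrite mxE.
Qed.

End UniformContinuity.

Section Composition.
Variables (R : realType) (m d : nat).

Lemma approximable_tent (f : 'rV[R]_m -> R) : approximable f ->
  approximable (fun x => tent (f x)).
Proof.
move=> fA; have gA : approximable (fun x => 1 + (-1) * `|f x|).
  apply: approximable_add; first exact: approximable_cst.
  apply: approximable_mul; [exact: approximable_cst|exact: approximable_abs].
rewrite (_ : (fun x => _) = fun x => 2^-1 * ((1 + (-1) * `|f x|) + `|1 + (-1) * `|f x| |)).
  apply: approximable_mul; first exact: approximable_cst.
  by apply: approximable_add => //; apply: approximable_abs.
by apply/funext => x; rewrite /tent mulN1r mulrC.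
Qed.

(* w o G is approximated by interpolating w on a grid of mesh h with a
   partition of unity made of products of tent functions. *)
Lemma approximable_comp (w : 'cV[R]_d -> R) (G : 'I_d -> 'rV[R]_m -> R) :
  continuous w -> (forall i, approximable (G i)) ->
  approximable (fun x => w (\col_i G i x)).
Proof.
move=> wc GA; have [B0 B0P] := choice (fun i => let: ex_intro2 b b0 bP :=
  approximable_bounded (GA i) in
  ex_intro (fun b => 0 < b /\ forall x, `|G i x| <= b) b (conj b0 bP)).
pose B := \sum_i B0 i.
have GB i x : `|G i x| <= B.
  have [_ /(_ x)] := B0P i; move/le_trans; apply.
  by rewrite /B (bigD1 i) //= lerDl sumr_ge0 // => j _; have [/ltW] := B0P j.
have BN0 : 0 <= B by apply: sumr_ge0 => j _; have [/ltW] := B0P j.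
apply: approximable_lim => e e0.
have [r r0 rP] := uniformly_continuous_box wc B e0.
(* The mesh is r and z ranges over [0, 2 B / r], so the nodes 0, ..., K cover it. *)
pose K := (Num.truncn (2 * B / r)).+1.
pose p (f : {ffun 'I_d -> 'I_K.+1}) : 'cV[R]_d := \col_i (r * (f i)%:R - B).
pose z i x := r^-1 * (G i x + B).
pose phi (f : {ffun 'I_d -> 'I_K.+1}) x := \prod_i tent (z i x - (f i)%:R).
have phi_ge0 f x : 0 <= phi f x by apply: prodr_ge0 => i _; apply: tent_ge0.
have phi1 x : \sum_f phi f x = 1.
  (* The sum over multi-indices of the products is the product of the one-dimensional sums, each
     equal to 1. *)
  rewrite /phi -(bigA_distr_bigA (fun i (j : 'I_K.+1) => tent (z i x - j%:R))).
  apply: big1 => i _; apply: tent_partition.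
  have := GB i x; rewrite ler_norml => /andP[G1 G2].
  apply/andP; split; first by apply: mulr_ge0; [rewrite invr_ge0 ltW|lra].
  rewrite ler_pdivrMl //; have : 2 * B / r < K%:R by exact: truncnS_gt.
  rewrite ltr_pdivrMr // mulrC; lra.
exists (fun x => \sum_f w (p f) * phi f x).
  apply: approximable_sum => f; apply: approximable_mul; first exact: approximable_cst.
  apply: approximable_prod => i; apply: approximable_tent.
  apply: approximable_add; last exact: approximable_cst.
  apply: approximable_mul; first exact: approximable_cst.
  by apply: approximable_add => //; exact: approximable_cst.
move=> x; rewrite -[w (\col_i _)]mulr1 -(phi1 x) mulr_sumr -sumrB.
rewrite (le_trans (ler_norm_sum _ _ _)) // -[leRHS]mulr1 -(phi1 x) mulr_sumr.
apply: ler_sum => f _; rewrite -mulrBl normrM [`|phi f x|]ger0_norm //.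
(* A product of hats is nonzero only if every coordinate of G x is within r of the grid point. *)
have [->|phin0] := eqVneq (phi f x) 0; first by rewrite !mulr0.
apply: ler_wpM2r => //; apply/ltW/rP => i; first by rewrite mxE.
rewrite !mxE; have zi : `|z i x - (f i)%:R| < 1.
  rewrite ltNge; apply: contra phin0 => zi.
  by rewrite /phi (bigD1 i) //= tent_out // mul0r.
have -> : G i x - (r * (f i)%:R - B) = r * (z i x - (f i)%:R).
  by rewrite /z mulrBr mulrA divff ?gt_eqF // mul1r; ring.
by rewrite normrM gtr0_norm // -[ltRHS]mulr1 ltr_pM2l.
Qed.

End Composition.

(** * The mean payoff *)

Section ExpressionValues.
Variables (R : realType) (d m : nat) (w : 'cV[R]_d -> R).
Local Notation K := R[i].
Local Notation val := (aterm_val R).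

Lemma expr_val_sum x (s : seq expr) :
  expr_val (m := m) w x (expr_sum s) = \sum_(e <- s) expr_val w x e.
Proof. by elim: s => [|e s IH]; rewrite ?big_nil ?big_cons /= ?rmorph0 // IH. Qed.

Let sig (x : 'rV[R]_m) (k : nat) : K := if insub k is Some k' then sigma x k' else 0.

(** Missing exponents count as 0 and surplus ones are cut off by [zip], in agreement with
    [polycode_val]. *)
Lemma expr_val_monomial x (es : seq nat) :
  expr_val w x (monomial_expr m es) = \prod_(k < m.*2) sigma x k ^+ nth 0 es k.
Proof.
have powE e k n : expr_val w x (iter n (EMul e) k) = expr_val w x e ^+ n * expr_val w x k.
  by elim: n => [|n IH] /=; rewrite ?expr0 ?mul1r // IH exprS mulrA.
have -> : expr_val w x (monomial_expr m es) = \prod_(t <- zip (iota 0 m.*2) es) sig x t.1 ^+ t.2.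
  rewrite /monomial_expr; elim: (zip _ _) => [|t s IH]; first by rewrite big_nil /= rmorph1.
  by rewrite big_cons /= IH powE /= rmorph1 mulr1.
have zipE a n : \prod_(t <- zip (iota a n) es) sig x t.1 ^+ t.2 =
    \prod_(k < n) sig x (a + k) ^+ nth 0 es k.
  elim: n a es {powE} => [|n IH] a [|e es] /=; rewrite ?big_nil ?big_ord0 //.
    by rewrite big1 // => k _; rewrite nth_nil expr0.
  rewrite big_cons big_ord_recl addn0 /= IH; congr (_ * _).
  by apply: eq_bigr => k _; rewrite addSnnS.
rewrite zipE; apply: eq_bigr => k _; rewrite /sig add0n; case: insubP => [k' _ kk'|].
  by congr (sigma x _ ^+ _); apply: ord_inj.
by rewrite ltn_ord.
Qed.

Lemma expr_val_poly x (c : polycode) :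
  expr_val w x (poly_expr m c) = meval (sigma x) (polycode_val R m.*2 c).
Proof.
rewrite /poly_expr expr_val_sum big_map /polycode_val.
elim: c => [|t c IH]; first by rewrite !big_nil meval0.
rewrite !big_cons mevalD mevalZ mevalX IH /= expr_val_monomial; congr (_ * _ + _).
by apply: eq_bigr => k _; rewrite mnmE.
Qed.

Lemma expr_val_coord l Rp (coefs : seq (seq aterm)) (code : 'I_l -> 'I_Rp -> polycode)
    x (r : 'I_Rp) i : size coefs = l ->
  expr_val w x (coord_expr m coefs
    [seq [seq code j r | r <- enum 'I_Rp] | j <- enum 'I_l] r i) =
  \sum_(j < l) val (nth (ARat 0) (nth [::] coefs j) i) *
    meval (sigma x) (polycode_val R m.*2 (code j r)).
Proof.
move=> sc; rewrite /coord_expr expr_val_sum big_map.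
have sp : size [seq [seq code j r | r <- enum 'I_Rp] | j <- enum 'I_l] = l.
  by rewrite size_map size_enum_ord.
rewrite (big_nth ([::], [::])) size_zip sc sp minnn big_mkord; apply: eq_bigr => j _.
rewrite nth_zip ?sc //= (nth_map j) ?size_enum_ord // nth_ord_enum.
by rewrite (nth_map r) ?size_enum_ord // nth_ord_enum expr_val_poly.
Qed.

Lemma expr_fun_payoff Rp (coefs : seq (seq aterm)) (ps : seq (seq polycode))
    (x : 'rV[R]_m) :
  expr_fun (payoff_expr d Rp m coefs ps) w x =
  Rp%:R^-1 * \sum_(r < Rp) w (\col_(i < d) complex.Re (expr_val w x (coord_expr m coefs ps r i))).
Proof.
rewrite /expr_fun /payoff_expr.
have -> : expr_val w x (EMul (EConst (AInv (asum [seq ARat 1 | _ <- iota 0 Rp])))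
    (expr_sum [seq EW [seq coord_expr m coefs ps r i | i <- iota 0 d] | r <- iota 0 Rp])) =
    (Rp%:R^-1 * \sum_(r < Rp) w (\col_(i < d) complex.Re
       (expr_val w x (coord_expr m coefs ps r i))))%:C%C; last by [].
rewrite rmorphM fmorphV rmorph_nat rmorph_sum.
transitivity (val (AInv (asum [seq ARat 1 | _ <- iota 0 Rp])) *
  expr_val w x (expr_sum [seq EW [seq coord_expr m coefs ps r i | i <- iota 0 d] | r <- iota 0 Rp])).
  by [].
congr (_ * _).
  rewrite /= val_asum big_map; congr _^-1.
  under eq_bigr => r _ do rewrite /= rmorph1.
  by rewrite big_const_seq count_predT size_iota iter_addr_0.
rewrite expr_val_sum big_map (_ : iota 0 Rp = index_iota 0 Rp) ?big_mkord; last first.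
  by rewrite /index_iota subn0.
apply: eq_bigr => r _ /=; congr (w _)%:C%C; apply/colP => i; rewrite !mxE; congr complex.Re.
by rewrite -map_comp (nth_map 0%N) ?size_iota // nth_iota.
Qed.

End ExpressionValues.

Section ComplexTrigonometricPolynomials.
Variables (R : realType) (m : nat).
Local Notation K := R[i].

Definition ctrigpoly (F : 'rV[R]_m -> K) :=
  trigpoly (fun x => complex.Re (F x)) /\ trigpoly (fun x => complex.Im (F x)).

Lemma ctrigpoly_cst c : ctrigpoly (fun=> c).
Proof. by split; apply: trigpoly_cst. Qed.

Lemma ctrigpoly_add F G : ctrigpoly F -> ctrigpoly G -> ctrigpoly (fun x => F x + G x).
Proof.
move=> [F1 F2] [G1 G2]; split.
  by apply: trigpoly_ext (trigpoly_add F1 G1) => x; rewrite raddfD.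
by apply: trigpoly_ext (trigpoly_add F2 G2) => x; rewrite raddfD.
Qed.

Lemma ctrigpoly_mul F G : ctrigpoly F -> ctrigpoly G -> ctrigpoly (fun x => F x * G x).
Proof.
move=> [F1 F2] [G1 G2]; split.
  apply: trigpoly_ext (trigpoly_add (trigpoly_mul F1 G1)
    (trigpoly_scale (-1) (trigpoly_mul F2 G2))) => x.
  by case: (F x) (G x) => a b [a' b'] /=; rewrite mulN1r.
apply: trigpoly_ext (trigpoly_add (trigpoly_mul F1 G2) (trigpoly_mul F2 G1)) => x.
by case: (F x) (G x) => a b [a' b'].
Qed.

Lemma ctrigpoly_exp F n : ctrigpoly F -> ctrigpoly (fun x => F x ^+ n).
Proof.
move=> FT; elim: n => [|n IH]; first exact: ctrigpoly_cst.
rewrite (_ : (fun x => _) = fun x => F x * F x ^+ n); first exact: ctrigpoly_mul.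
by apply/funext => x; rewrite exprS.
Qed.

Lemma ctrigpoly_sum (J : Type) (r : seq J) F :
  (forall j, ctrigpoly (F j)) -> ctrigpoly (fun x => \sum_(j <- r) F j x).
Proof.
move=> FA; elim: r => [|j r IH].
  rewrite (_ : (fun _ => _) = fun=> 0); first exact: ctrigpoly_cst.
  by apply/funext => x; rewrite big_nil.
rewrite (_ : (fun _ => _) = fun x => F j x + \sum_(j <- r) F j x).
  exact: ctrigpoly_add.
by apply/funext => x; rewrite big_cons.
Qed.

Lemma ctrigpoly_prod (J : Type) (r : seq J) F :
  (forall j, ctrigpoly (F j)) -> ctrigpoly (fun x => \prod_(j <- r) F j x).
Proof.
move=> FA; elim: r => [|j r IH].
  rewrite (_ : (fun _ => _) = fun=> 1); first exact: ctrigpoly_cst.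
  by apply/funext => x; rewrite big_nil.
rewrite (_ : (fun _ => _) = fun x => F j x * \prod_(j <- r) F j x).
  exact: ctrigpoly_mul.
by apply/funext => x; rewrite big_cons.
Qed.

(** The sine is a cosine with phase -pi / 2, and the two parities of [k] are the frequencies z = 1
    and z = -1. *)
Lemma ctrigpoly_sigma (k : 'I_m.*2) : ctrigpoly (fun x => sigma x k).
Proof.
pose j := Ordinal (half_ord_proof k).
have linE (x : 'rV[R]_m) (z : int) : lin (fun i => if i == j then z else 0) x = z%:~R * x ord0 j.
  rewrite /lin (bigD1 j) //= eqxx big1 ?addr0 // => i /negPf ->.
  by rewrite mul0r.
have cisT (z : int) : ctrigpoly (fun x : 'rV[R]_m => cis (2 * pi * (z%:~R * x ord0 j))).
  split.
    apply: trigpoly_ext (trigpoly_wave 1 (fun i => if i == j then z else 0) 0) => x.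
    by rewrite /wave linE addr0 mul1r.
  apply: trigpoly_ext (trigpoly_wave 1 (fun i => if i == j then z else 0) (- (pi / 2))) => x.
  by rewrite /wave linE mul1r cosBpihalf.
rewrite /sigma; case: (odd k).
  rewrite (_ : (fun x => _) = fun x : 'rV[R]_m => cis (2 * pi * ((-1)%:~R * x ord0 j))) //.
  by apply/funext => x; congr cis; rewrite mulN1r mulrN.
rewrite (_ : (fun x => _) = fun x : 'rV[R]_m => cis (2 * pi * (1%:~R * x ord0 j))) //.
by apply/funext => x; congr cis; rewrite mul1r.
Qed.

Lemma ctrigpoly_meval (p : mpoly m.*2 K) : ctrigpoly (fun x => meval (sigma x) p).
Proof.
rewrite (_ : (fun x => _) = fun x => \sum_(s <- msupp p)
  mcoeff s p * \prod_i sigma x i ^+ s i); last by apply/funext => x; rewrite mevalE.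
apply: ctrigpoly_sum => s; apply: ctrigpoly_mul; first exact: ctrigpoly_cst.
by apply: ctrigpoly_prod => i; apply: ctrigpoly_exp; apply: ctrigpoly_sigma.
Qed.

End ComplexTrigonometricPolynomials.

(** * Cesaro means and residue classes *)

Section Cesaro.
Variable R : realType.

Lemma cesaro_vanishing (a : nat -> R) : vanishing a -> vanishing (average a).
Proof.
move=> a0 e e0; have e2 : 0 < e / 2 by rewrite divr_gt0.
have [N NP] := a0 _ e2; pose C := \sum_(0 <= i < N) `|a i|.
have C0 : 0 <= C by apply: sumr_ge0.
have bound n : \sum_(0 <= i < n) `|a i| <= C + n%:R * (e / 2).
  elim: n => [|n IH]; first by rewrite big_nil mul0r addr0.
  have [nN|Nn] := ltnP n N.
    apply: (@le_trans _ _ C); last by rewrite lerDl mulr_ge0 // ltW.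
    by rewrite /C [leRHS](big_cat_nat (n := n.+1)) //= lerDl sumr_ge0.
  by rewrite big_nat_recr //= -natr1 mulrDl mul1r addrA lerD // ltW // NP.
have CC (n : nat) : `|C| <= C by rewrite ger0_norm.
have [N' N'P] := vanishing_bounded_div CC e2.
exists N'.+1 => n nN; have /N'P : (N' <= n)%N by exact: ltnW.
have n0 : 0 < n%:R :> R by rewrite ltr0n (leq_ltn_trans _ nN).
rewrite /average !normrM normfV (gtr0_norm n0) (ger0_norm C0) => Cn.
apply: (@le_lt_trans _ _ (n%:R^-1 * (C + n%:R * (e / 2)))).
  by rewrite ler_pM2l ?invr_gt0 // (le_trans (ler_norm_sum _ _ _)).
by rewrite mulrDr mulKf ?gt_eqF // [ltRHS]splitr ltrD2r.
Qed.

Lemma sum_blocks (b : nat -> R) (p q s : nat) :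
  \sum_(0 <= k < q * p + s) b k =
  \sum_(r < p) \sum_(0 <= n < q) b (n * p + r)%N + \sum_(i < s) b (q * p + i)%N.
Proof.
have E a t : \sum_(0 <= k < a + t) b k = \sum_(0 <= k < a) b k + \sum_(i < t) b (a + i)%N.
  by rewrite !big_mkord big_split_ord.
rewrite E; congr (_ + _); elim: q => [|q IH].
  by rewrite big_nil big1 // => r _; rewrite big_nil.
rewrite mulSnr E IH -big_split /=; apply: eq_bigr => r _.
by rewrite big_nat_recr.
Qed.

(** The first n terms are n / p complete blocks of length p and a remainder of fewer than p bounded
    terms, whose share in the average is O(1 / n). *)
Lemma average_interleave (b : nat -> R) (p : nat) (L : 'I_p -> R) (B : R) :
  (0 < p)%N -> (forall n, `|b n| <= B) ->
  (forall r : 'I_p, vanishing (fun n => average (fun k => b (k * p + r)%N) n - L r)) ->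
  vanishing (fun n => average b n - p%:R^-1 * \sum_r L r).
Proof.
move=> p0 bB bL; set l := p%:R^-1 * _; have pR : p%:R != 0 :> R by rewrite pnatr_eq0 -lt0n.
have lE : \sum_r L r = p%:R * l by rewrite /l mulVKf.
pose E n := \sum_(i < n %% p) b (n %/ p * p + i)%N - (n %% p)%:R * l.
pose D n := \sum_(r < p) (average (fun k => b (k * p + r)%N) n - L r).
(* The last term corrects n = 0, where the average is 0 because 0^-1 = 0. *)
have split_avg n : average b n - l =
    n%:R^-1 * (n %/ p)%:R * D (n %/ p)%N + n%:R^-1 * E n - (n == 0)%:R * l.
  have [->|n0] := eqVneq n 0%N.
    by rewrite /average invr0 !mul0r !add0r mul1r.
  have nR : n%:R != 0 :> R by rewrite pnatr_eq0.
  have nE : n%:R = (n %/ p)%:R * p%:R + (n %% p)%:R :> R.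
    by rewrite -natrM -natrD -divn_eq.
  rewrite mul0r subr0 -mulrA -mulrDr /average {2}(divn_eq n p) sum_blocks /D /E.
  rewrite sumrB mulrBr; apply: (mulfI nR); rewrite mulrBr !mulVKf // nE.
  suff -> : (n %/ p)%:R * \sum_(i < p) average (fun k => b (k * p + i)%N) (n %/ p) =
      \sum_(r < p) \sum_(0 <= k < n %/ p) b (k * p + r)%N.
    by rewrite lE; ring.
  rewrite mulr_sumr; apply: eq_bigr => r _; rewrite /average.
  have [->|q0] := eqVneq (n %/ p)%N 0%N; first by rewrite mul0r big_nil.
  by rewrite mulVKf // pnatr_eq0.
have D0 : vanishing D.
  rewrite /D; elim: (index_enum _) => [|r s IH].
    by move=> e e0; exists 0%N => n _; rewrite big_nil normr0.
  apply: eq_vanishing (vanishing_add (bL r) IH) => n.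
  by rewrite big_cons.
apply: eq_vanishing (fun n => esym (split_avg n)) _.
apply: vanishing_add; last first.
  by move=> e e0; exists 1%N => n; rewrite lt0n => /negPf ->; rewrite mul0r oppr0 normr0.
apply: vanishing_add; last first.
  apply: (@vanishing_bounded_div _ (p%:R * B + p%:R * `|l|)) => n.
  have B0 : 0 <= B by apply: le_trans (bB 0%N).
  rewrite (le_trans (ler_normB _ _)) // lerD //; last first.
    by rewrite normrM normr_nat ler_wpM2r // ler_nat ltnW // ltn_mod.
  rewrite (le_trans (ler_norm_sum _ _ _)) //.
  rewrite (le_trans (ler_sum _ (fun i _ => bB _))) // sumr_const card_ord -[B *+ _]mulr_natl.
  by rewrite ler_wpM2r // ler_nat ltnW // ltn_mod.
move=> e e0; have [N NP] := D0 e e0; exists (N * p)%N => n nN.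
have {}NP : `|D (n %/ p)%N| < e by apply: NP; rewrite leq_divRL.
rewrite normrM; apply: le_lt_trans NP; rewrite ler_piMl //.
have [->|n0] := eqVneq n 0%N; first by rewrite invr0 mul0r normr0.
rewrite normrM normfV !normr_nat ler_pdivrMl ?ltr0n ?lt0n // mulr1 ler_nat.
exact: leq_div.
Qed.

End Cesaro.

Lemma enc_seq_map (S T : Type) (e : T -> btree) (f : S -> T) (s : seq S) :
  enc_seq e [seq f x | x <- s] = enc_seq (fun x => e (f x)) s.
Proof. exact: foldr_map. Qed.

Definition mx_rows (T : Type) (m n : nat) (A : 'M[T]_(m, n)) : seq (seq T) :=
  [seq [seq A i j | j <- enum 'I_n] | i <- enum 'I_m].

Lemma enc_mxE (m n : nat) (A : 'M[rat]_(m, n)) :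
  enc_mx A = enc_seq (enc_seq enc_rat) (mx_rows A).
Proof.
rewrite /enc_mx /enc_fun /mx_rows !map_id [RHS]enc_seq_map.
by congr (enc_seq _ _); apply/funext => i; rewrite [RHS]enc_seq_map.
Qed.

Lemma nth_map_enum (T : Type) (x0 : T) n (f : 'I_n -> T) (i : 'I_n) :
  nth x0 [seq f j | j <- enum 'I_n] i = f i.
Proof. by rewrite (nth_map i) ?size_enum_ord // nth_ord_enum. Qed.

Section Payoff.
Variable R : realType.
Local Notation K := R[i].
Local Notation I := (@torus_integral R _).

Lemma reps_matrix d (M : 'M[rat]_d) (i : 'I_d) :
  reps (R := R) (nth [::] (aterm_of_rats (mx_rows M)) i) (map_mx ratr M i : 'I_d -> K).
Proof.
rewrite /aterm_of_rats /mx_rows -map_comp nth_map_enum /= -map_comp; split.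
  by rewrite size_map size_enum_ord.
by move=> j; rewrite nth_map_enum mxE.
Qed.

Lemma reps_vector d (q : 'cV[rat]_d) :
  reps (R := R) [seq asum t | t <- aterm_of_rats (mx_rows q)]
    (fun i : 'I_d => map_mx ratr q i ord0 : K).
Proof.
rewrite /aterm_of_rats /mx_rows -2!map_comp; split.
  by rewrite size_map size_enum_ord.
move=> i; rewrite nth_map_enum /= val_asum -map_comp big_map big_enum big_ord1 mxE.
by rewrite ord1.
Qed.

Lemma torus_integral_sum m (J : Type) (r : seq J) (f : J -> 'rV[R]_m -> R) a :
  (forall j, ucb (f j)) ->
  I (fun x => a * \sum_(j <- r) f j x) = a * \sum_(j <- r) I (f j).
Proof.
have [L _] := torus_integral_linear_bounded R m; move=> fu.
have ucb0 : ucb (fun _ : 'rV[R]_m => 0 : R).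
  by split; [exists 0 => x; rewrite normr0|move=> e e0; exists 1 => // *; rewrite subrr normr0].
have H : ucb (fun x => \sum_(j <- r) f j x) /\
    I (fun x => \sum_(j <- r) f j x) = \sum_(j <- r) I (f j).
  elim: r => [|j r [IHu IHI]].
    rewrite big_nil (_ : (fun x => _) = fun=> 0); last by apply/funext => x; rewrite big_nil.
    by split=> //; rewrite torus_integral_cst.
  rewrite big_cons -IHI.
  rewrite (_ : (fun x => _) = fun x => 1 * f j x + 1 * \sum_(j <- r) f j x); last first.
    by apply/funext => x; rewrite big_cons !mul1r.
  by split; [exact: ucb_lin|rewrite L // !mul1r].
have [Hu <-] := H; have := L _ _ a 0 Hu Hu; rewrite mul0r addr0 => <-.
by congr (torus_integral _); apply/funext => x; rewrite mul0r addr0.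
Qed.

Lemma vanishing_cvg (u : nat -> R) (l : R) :
  vanishing (fun n => u n - l) -> u @ \oo --> l.
Proof.
move=> ul; apply/cvgrPdist_lt => e /ul[N NP].
by exists N => // n /= /NP; rewrite distrC.
Qed.

(** Along k = n Rp + r the modulus-one part is G r on the orbit of theta, so its payoff averages
    converge class by class; the decaying part changes the averages by a Cesaro mean that tends to
    0. *)
Lemma payoff_limit d (M : 'M[rat]_d) (q : 'cV[rat]_d) (l Rp m : nat)
    (lambda : 'I_l -> K) (theta : 'rV[R]_m) (p : 'I_l -> 'I_Rp -> mpoly m.*2 K)
    (lambda_code : 'I_l -> aterm) (p_code : 'I_l -> 'I_Rp -> polycode) (w : 'cV[R]_d -> R) :
  spectral_set M q lambda ->
  torus_parametrization lambda theta p ->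
  (forall i, aterm_val R (lambda_code i) = lambda i) ->
  (forall i r, polycode_val R m.*2 (p_code i r) = p i r) ->
  continuous w ->
  let e := payoff_expr d Rp m
    (spectral_coefs d (aterm_of_rats (mx_rows M)) [seq asum t | t <- aterm_of_rats (mx_rows q)]
       [seq lambda_code j | j <- enum 'I_l])
    [seq [seq p_code j r | r <- enum 'I_Rp] | j <- enum 'I_l] in
  payoff_average w M q @ \oo --> torus_integral (fun x : 'rV[R]_m => expr_fun e w x).
Proof.
move=> spec [[Rp0 _] _ indep _ param] lamP pP wc; set coefs := spectral_coefs _ _ _ _ => e.
have [|v [uv vE]] := @spectral_coefs_closed_form R d M q l lambda lambda_code
  (aterm_of_rats (mx_rows M)) _ spec lamP _ (reps_matrix M) (reps_vector q).
  by rewrite /aterm_of_rats /mx_rows 2!size_map size_enum_ord.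
rewrite -/coefs in vE.
have scoefs : size coefs = l by rewrite 2!size_map size_enum_ord.
pose c i j := aterm_val R (nth (ARat 0) (nth [::] coefs j) i).
pose G (r : 'I_Rp) (i : 'I_d) x : R :=
  complex.Re (\sum_(j < l) c i j * meval (sigma x) (p j r)).
pose H r x := w (\col_i G r i x).
have GA r i : approximable (G r i).
  apply: approximable_trigpoly.
  have [] : ctrigpoly (fun x : 'rV[R]_m => \sum_(j < l) c i j * meval (sigma x) (p j r)).
    apply: ctrigpoly_sum => j; apply: ctrigpoly_mul; first exact: ctrigpoly_cst.
    exact: ctrigpoly_meval.
  by [].
have HA r : approximable (H r) by exact: approximable_comp.
have eE : (fun x : 'rV[R]_m => expr_fun e w x) = fun x => Rp%:R^-1 * \sum_(r < Rp) H r x.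
  apply/funext => x; rewrite expr_fun_payoff; congr (_ * _); apply: eq_bigr => r _.
  congr (w _); apply/colP => i; rewrite !mxE expr_val_coord //; congr complex.Re.
  by apply: eq_bigr => j _; rewrite pP.
rewrite eE torus_integral_sum; last by move=> r; exact: ucb_approximable.
have Gv r i n : G r i (torus_orbit theta n) = v i (n * Rp + r)%N.
  rewrite /G; have -> : \sum_(j < l) c i j * meval (sigma (torus_orbit theta n)) (p j r) =
      (v i (n * Rp + r)%N)%:C%C; last by [].
  by rewrite vE; apply: eq_bigr => j _; rewrite param.
have Hv r n : H r (torus_orbit theta n) = w (\col_i v i (n * Rp + r)%N).
  by rewrite /H; congr (w _); apply/colP => i; rewrite !mxE Gv.
apply: vanishing_cvg.
pose b k := w (\col_i v i k).
have blockE k : exists r : 'I_Rp, k = (k %/ Rp * Rp + r)%N.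
  by exists (Ordinal (ltn_pmod k Rp0)); rewrite /= -divn_eq.
have [Hb HbP] := choice (fun r => let: ex_intro2 B B0 BP := approximable_bounded (HA r) in
  ex_intro (fun B => forall x, `|H r x| <= B) B BP).
(* Every k lies in some residue class, so bounds of the finitely many H r bound b. *)
have bB k : `|b k| <= \sum_r `|Hb r|.
  have [r ->] := blockE k; rewrite /b -Hv (bigD1 r) //=.
  rewrite (le_trans (HbP r _)) // (le_trans (ler_norm _)) // lerDl sumr_ge0 //.
have bL : vanishing (fun n => average b n - Rp%:R^-1 * \sum_r I (H r)).
  apply: (average_interleave Rp0 bB) => r.
  apply: eq_vanishing (approximable_equidistributed indep (HA r)) => n.
  by congr (average _ _ - _); apply/funext => k; rewrite Hv.
have [Gb GbP] := choice (fun ri : 'I_Rp * 'I_d =>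
  let: ex_intro2 B B0 BP := approximable_bounded (GA ri.1 ri.2) in
  ex_intro (fun B => forall x, `|G ri.1 ri.2 x| <= B) B BP).
pose B := \sum_ri `|Gb ri|.
have vB i k : `|v i k| <= B.
  have [r ->] := blockE k; rewrite -Gv /B (bigD1 (r, i)) //=.
  by rewrite (le_trans (GbP (r, i) _)) // (le_trans (ler_norm _)) // lerDl sumr_ge0.
have diff : vanishing (fun k => w (orbit_point R M q k) - b k).
  move=> eps eps0; have [r r0 rP] := uniformly_continuous_box wc B eps0.
  have [N NP] := choice (fun i => uv i r r0).
  exists (\sum_i N i)%N => k kN; rewrite distrC; apply: rP => i; rewrite mxE //.
  by rewrite distrC; apply: NP; apply: leq_trans kN; rewrite (bigD1 i) //= leq_addr.
apply: eq_vanishing (vanishing_add (cesaro_vanishing diff) bL) => n.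
rewrite /payoff_average /average sumrB mulrBr; ring.
Qed.

End Payoff.

Theorem theorem14 (R : realType) :
  exists P : prog,
  forall (d : nat) (M : 'M[rat]_d) (q : 'cV[rat]_d)
         (l Rp m : nat) (lambda : 'I_l -> R[i]) (theta : 'rV[R]_m)
         (p : 'I_l -> 'I_Rp -> mpoly m.*2 R[i])
         (lambda_code : 'I_l -> aterm) (p_code : 'I_l -> 'I_Rp -> polycode),
    bounded_set (range (@orbit_point R d M q)) ->
    spectral_set M q lambda ->
    torus_parametrization lambda theta p ->
    (forall i, aterm_val R (lambda_code i) = lambda i) ->
    (forall i r, polycode_val R m.*2 (p_code i r) = p i r) ->
    exists e : expr,
      run P (enc_input M q m lambda_code p_code) (enc_expr e) /\
      forall w : 'cV[R]_d -> R, continuous w ->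
        cvgn (payoff_average w M q) /\
        mean_payoff w M q = torus_integral (fun x : 'rV[R]_m => expr_fun e w x).
Proof.
have [P PP] := computes_build_expr; exists P.
move=> d M q l Rp m lambda theta p lambda_code p_code _ spec param lamP pP.
pose x : input := (d, (mx_rows M, (mx_rows q, (l, (Rp, (m,
  ([seq lambda_code j | j <- enum 'I_l],
   ([seq [seq p_code j r | r <- enum 'I_Rp] | j <- enum 'I_l], tt)))))))).
exists (build_expr x); split=> [|w wc].
  rewrite (_ : enc_input _ _ _ _ _ = enc_typed_input x); first exact: PP.
  rewrite /enc_input !enc_mxE /enc_typed_input /enc_pair /= enc_seq_map.
  by rewrite /enc_fun !enc_seq_map.
have lim := payoff_limit spec param lamP pP wc.
by split; [apply: cvgP lim|apply: cvg_lim lim; exact: Rhausdorff].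
Qed.
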